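(* (i) For any $h\in\mathcal H$ there exists a unique matrix Wiener-Hopf factorisation of $Q_h$, denoted by $(\eta_h^+,Q_h^+,\eta_h^-,Q_h^-)$. (ii) If $h=\Re(h)$ (i.e. $h$ is real-valued), then $Q_h^+\in\mathbb G(N^+)$ and $Q_h^-\in\mathbb G(N^-)$ are sub-generator matrices, and $\eta_h^+\in\mathbb H(N,N^+)$ and $\eta_h^-\in\mathbb H(N,N^-)$ are, in block notation, given by $$\eta_h^+=\begin{pmatrix} I_+\\ \underline\eta_h^+\end{pmatrix},\qquad \eta_h^-=\begin{pmatrix}\underline\eta_h^-\\ I_-\end{pmatrix},$$ for some matrices $\underline\eta_h^+\in\mathbb H(\underline N^-,N^+)$ and $\underline\eta_h^-\in\mathbb H(\underline N^+,N^-)$, where $I_+$ and $I_-$ are identity matrices of sizes $N^+\times N^+$ and $N^-\times N^-$.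
   Context: Let $Z$ be a continuous-time Markov chain on $E^0=\{1,\dots,N_0\}$ with generator $Q$, and let $X_t=x+\int_0^t\mu(Z_s)\,ds+\int_0^t\sigma(Z_s)\,dW_s+\sum_{i\in E^0}\int_0^t I_{\{Z_s=i\}}\,dJ^i_s$, where $W$ is a Brownian motion, $\sigma>0$, and the $J^i$ are independent compound Poisson processes with intensity $\lambda_i$ and double phase-type jump law with parameters $(p_i,\beta_i^+,B_i^+,\beta_i^-,B_i^-)$ (upward jumps $PH(\beta_i^+,B_i^+)$ with probability $p_i$, downward jumps minus a $PH(\beta_i^-,B_i^-)$ variable with probability $1-p_i$). Define, in block notation, $$Q_0=\begin{pmatrix}B^+ & b^+ & O\\ A^+ & Q-\Lambda_\lambda & A^-\\ O & b^- & B^-\end{pmatrix},\quad \Sigma=\begin{pmatrix}O&O&O\\O&\Lambda_S&O\\O&O&O\end{pmatrix},\quad V=\begin{pmatrix}I&O&O\\O&\Lambda_M&O\\O&O&-I\end{pmatrix},$$ where $\Lambda_\lambda,\Lambda_S,\Lambda_M$ are diagonal with entries $\lambda_i,\sigma(i),\mu(i)$; $A^\pm=\mathrm{diag}(\lambda_i^\pm(\beta_i^\pm)')$, $B^\pm=\mathrm{diag}(B_i^\pm)$, $b^\pm=\mathrm{diag}(-B_i^\pm\mathbf 1)$ (block diagonal), $\lambda_i^+=\lambda_ip_i$, $\lambda_i^-=\lambda_i(1-p_i)$. $Q_0$ is a generator on a state space $E$, partitioned as $E^0=\{i:\Sigma_{ii}\neq0\}$, $E^+=\{i:\Sigma_{ii}=0,V_{ii}>0\}$,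 $E^-=\{i:\Sigma_{ii}=0,V_{ii}<0\}$. Let $N,N^+,\underline N^+,N^-,\underline N^-$ be the cardinalities of $E$, $E^0\cup E^+$, $E^+$, $E^0\cup E^-$, $E^-$. Let $\mathcal H=\{h:E\to\mathbb C:\min_{i\in E}\Re h(i)\ge0,\ \min_{i\in E^0}\Re h(i)>0\}$, $\Lambda_h=\mathrm{diag}(h(i))$ and $Q_h=Q_0-\Lambda_h$. $\mathbb D(n)$ denotes $n\times n$ complex matrices whose eigenvalues all have non-positive real part, $\mathbb G(n)$ the $n\times n$ sub-generator matrices (non-negative off-diagonal entries, non-positive row sums), $\mathbb H(n,m)$ the $n\times m$ sub-probability matrices (non-negative entries, row sums $\le1$). A quadruple $(W^+,G^+,W^-,G^-)$ with $W^+\in\mathbb C^{N\times N^+}$, $G^+\in\mathbb D(N^+)$, $W^-\in\mathbb C^{N\times N^-}$, $G^-\in\mathbb D(N^-)$ is a matrix Wiener-Hopf factorisation of $Q_h$ if $\tfrac12\Sigma^2W^+(G^+)^2-VW^+G^++Q_hW^+=O$ and $\tfrac12\Sigma^2W^-(G^-)^2+VW^-G^-+Q_hW^-=O$ (zero matrices of sizes $N\times N^+$ and $N\times N^-$).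
   Formalization: The definition of a matrix Wiener-Hopf factorisation is taken to include, for every h, the block normalisation W^+ = (I_+; ·), W^- = (·; I_-); without it uniqueness fails, since W^± = 0 with any G^± in D solves both equations. *)

(* Defs.v *)
From mathcomp Require Import all_boot all_algebra.
From mathcomp Require Import reals.
From mathcomp Require Export complex.
Set Implicit Arguments. Unset Strict Implicit. Unset Printing Implicit Defensive.
Import GRing.Theory Num.Theory.
Local Open Scope ring_scope.

(* 𝔾(n): sub-generator matrices (non-negative off-diagonal entries,
   non-positive row sums). Over C (partial order) this forces real entries. *)
Definition subgenerator (K : numDomainType) n (A : 'M[K]_n) : Prop :=
  (forall i j, i != j -> 0 <= A i j) /\ (forall i, \sum_j A i j <= 0).

Definition generator (K : numDomainType) n (A : 'M[K]_n) : Prop :=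
  (forall i j, i != j -> 0 <= A i j) /\ (forall i, \sum_j A i j = 0).

Definition subprob (K : numDomainType) n m (A : 'M[K]_(n, m)) : Prop :=
  (forall i j, 0 <= A i j) /\ (forall i, \sum_j A i j <= 1).

Definition probvec (K : numDomainType) m (b : 'rV[K]_m) : Prop :=
  (forall j, 0 <= b 0 j) /\ \sum_j b 0 j = 1.

(* parameters (beta, B) of a phase-type law PH(beta, B): beta a probability
   vector, B a sub-generator with all phases transient (B non-singular) *)
Definition PHparams (R : realType) m (beta : 'rV[R]_m) (B : 'M[R]_m) : Prop :=
  probvec beta /\ subgenerator B /\ B \in unitmx.

Definition Dmat (R : realType) n (G : 'M[R[i]]_n) : Prop :=
  forall a : R[i], eigenvalue G a -> 'Re a <= 0.

(* State space E ordered as (E^+ , E^0 , E^-) = (upward phases, Markov states,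
   downward phases); sizes Np = sum_i mp i, n0 = N_0, Nm = sum_i mm i.
   Matrices on E have type 'M_((Np + n0) + Nm). *)

Section Model.
Variables (R : realType) (n0 : nat) (mp mm : 'I_n0 -> nat).

Definition Np := (\sum_(i < n0) mp i)%N.
Definition Nm := (\sum_(i < n0) mm i)%N.

Variables (Q : 'M[R]_n0) (mu sigma lam p : 'I_n0 -> R).
Variables (betap : forall i, 'rV[R]_(mp i)) (Bp : forall i, 'M[R]_(mp i)).
Variables (betam : forall i, 'rV[R]_(mm i)) (Bm : forall i, 'M[R]_(mm i)).

Definition lamp i := lam i * p i.
Definition lamm i := lam i * (1 - p i).

Definition BPlus : 'M[R]_Np := \mxdiag_(i < n0) Bp i.
Definition BMinus : 'M[R]_Nm := \mxdiag_(i < n0) Bm i.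
(* b^± = diag(-B_i^± 1) : column i of block i is -B_i 1 *)
Definition bPlus : 'M[R]_(Np, n0) :=
  \mxcol_(i < n0) ((- (Bp i *m const_mx 1)) *m delta_mx (0 : 'I_1) i).
Definition bMinus : 'M[R]_(Nm, n0) :=
  \mxcol_(i < n0) ((- (Bm i *m const_mx 1)) *m delta_mx (0 : 'I_1) i).
(* A^± = diag(lambda_i^± beta_i^±) : row i of block i is lambda_i^± beta_i^± *)
Definition APlus : 'M[R]_(n0, Np) :=
  \mxrow_(i < n0) (delta_mx i (0 : 'I_1) *m (lamp i *: betap i)).
Definition AMinus : 'M[R]_(n0, Nm) :=
  \mxrow_(i < n0) (delta_mx i (0 : 'I_1) *m (lamm i *: betam i)).

Definition diagf n (f : 'I_n -> R) : 'M[R]_n := diag_mx (\row_i f i).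

Definition Q0 : 'M[R]_((Np + n0) + Nm) :=
  block_mx (block_mx BPlus bPlus APlus (Q - diagf lam))
           (col_mx 0 AMinus)
           (row_mx 0 bMinus)
           BMinus.

Definition SigmaM : 'M[R]_((Np + n0) + Nm) :=
  block_mx (block_mx 0 0 0 (diagf sigma)) 0 0 0.

Definition VM : 'M[R]_((Np + n0) + Nm) :=
  block_mx (block_mx 1%:M 0 0 (diagf mu)) 0 0 (- 1%:M).

End Model.

Notation toC := (map_mx (real_complex _)).

Definition Qh (R : realType) N (Q0m : 'M[R]_N) (h : 'rV[R[i]]_N) : 'M[R[i]]_N :=
  toC Q0m - diag_mx h.

Definition in_H (R : realType) (np n0 nm : nat) (h : 'rV[R[i]]_((np + n0) + nm)) : Prop :=
  (forall k, 0 <= 'Re (h 0 k)) /\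
  (forall i : 'I_n0, 0 < 'Re (h 0 (lshift nm (rshift np i)))).

(* Matrix Wiener-Hopf factorisation of Qh (with Sigma, V), including the
   normalisation W^+ = (I_+ ; W_^+), W^- = (W_^- ; I_-) (rows ordered
   (E^+ ∪ E^0, E^-) resp. (E^+, E^0 ∪ E^-)). *)
Definition is_mWHF (R : realType) (np n0 nm : nat)
  (Sig V Qhm : 'M[R[i]]_((np + n0) + nm))
  (Wp : 'M[R[i]]_((np + n0) + nm, np + n0)) (Gp : 'M[R[i]]_(np + n0))
  (Wm : 'M[R[i]]_((np + n0) + nm, n0 + nm)) (Gm : 'M[R[i]]_(n0 + nm)) : Prop :=
  Dmat Gp /\ Dmat Gm /\
  (exists U : 'M[R[i]]_(nm, np + n0), Wp = col_mx 1%:M U) /\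
  (exists U : 'M[R[i]]_(np, n0 + nm),
      Wm = castmx (addnA np n0 nm, erefl (n0 + nm)) (col_mx U 1%:M)) /\
  (2%:R^-1 *: (Sig *m Sig *m Wp *m (Gp *m Gp)) - V *m Wp *m Gp + Qhm *m Wp = 0) /\
  (2%:R^-1 *: (Sig *m Sig *m Wm *m (Gm *m Gm)) + V *m Wm *m Gm + Qhm *m Wm = 0).

(* Main.v *)
Require Import Defs.
From mathcomp Require Import all_boot all_order all_algebra.
From mathcomp Require Import classical_sets reals complex.
From mathcomp Require Import ring lra.
Set Implicit Arguments. Unset Strict Implicit. Unset Printing Implicit Defensive.
Import Order.TTheory GRing.Theory Num.Theory.
Local Open Scope ring_scope.

(** Write the equation row by row as s W G^2 - v W G + Q_h W = 0 with
    s = sigma^2 / 2; the "minus" equation is the same one for -G.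

    Existence. Let c be the off-diagonal part of Q_0.  On the rows where W is
    the identity, factoring s x^2 - v x + (q - h) = -(x - d) (r - s x) with
    Re d < 0 < Re r turns the equation into (G_k - d e_k) (r - s G) = c_k W; on
    the other rows it reads W_k (r - G) = c_k W with r = h - q.  Solving by
    iteration of the resolvents from zero gives, for real h, a non-decreasing
    sequence of sub-generators and sub-probabilities, and for complex h a
    sequence whose increments are dominated entrywise by those of the sequence
    for Re h, hence a convergent one.  The limit G is dominated by a
    sub-generator, so its spectrum lies in the closed left half-plane.

    Uniqueness. A solution (W, G) spans an invariant subspace of the companion
    matrix of the quadratic pencil, whose size is N + N_0.  Since the phase
    generators are non-singular there is w > 0 with (Q_0 - Re h) w < 0, and the
    resulting diagonal dominance excludes imaginary eigenvalues; so the spectra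
    of G^+ and -G^- are disjoint.  The dimensions of the two subspaces add up to
    N + N_0, which leaves room for only one of each kind. *)

(** * Real-valued moduli and entrywise domination of complex matrices by real ones *)

Section Modulus.
Variable R : realType.
Local Notation C := R[i].

(** The norm on [R[i]] takes its values in [R[i]]; its real part can be compared with real bounds in
    a total order. *)
Definition absc (z : C) : R := complex.Re `|z|.

Lemma absc_norm z : (real_complex R (absc z)) = `|z|.
Proof. exact/RRe_real/normr_real. Qed.

Lemma lecRR (x y : R) : (real_complex R x <= real_complex R y) = (x <= y).
Proof. by rewrite lecE /= eqxx. Qed.

Lemma ltcRR (x y : R) : (real_complex R x < real_complex R y) = (x < y).
Proof. by rewrite ltcE /= eqxx. Qed.

Lemma absc_ge0 z : 0 <= absc z.
Proof. by rewrite -lecRR absc_norm rmorph0. Qed.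

Lemma absc0 : absc 0 = 0. Proof. by rewrite /absc normr0. Qed.

Lemma absc_eq0 z : (absc z == 0) = (z == 0).
Proof. by rewrite -(inj_eq (@complexI R)) absc_norm rmorph0 normr_eq0. Qed.

Lemma abscM x y : absc (x * y) = absc x * absc y.
Proof. by apply: (@complexI R); rewrite rmorphM /= !absc_norm normrM. Qed.

Lemma abscN x : absc (- x) = absc x.
Proof. by rewrite /absc normrN. Qed.

Lemma abscB x y : absc (x - y) = absc (y - x).
Proof. by rewrite -abscN opprB. Qed.

Lemma ler_abscD x y : absc (x + y) <= absc x + absc y.
Proof. by rewrite -lecRR rmorphD /= !absc_norm ler_normD. Qed.

Lemma ler_absc_sum I (r : seq I) (P : pred I) (F : I -> C) :
  absc (\sum_(i <- r | P i) F i) <= \sum_(i <- r | P i) absc (F i).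
Proof.
elim/big_rec2: _ => [|i y x _ le_xy]; first by rewrite absc0.
by apply: le_trans (ler_abscD _ _) _; rewrite lerD2l.
Qed.

Lemma absc_real (x : R) : absc (real_complex R x) = `|x|.
Proof.
apply: (@complexI R); rewrite absc_norm normc_def /=.
by rewrite expr0n /= addr0 sqrtr_sqr.
Qed.

Lemma normRe_le_absc z : `|complex.Re z| <= absc z.
Proof. by rewrite -lecRR absc_norm normc_ge_Re. Qed.

Lemma Re_le_absc z : complex.Re z <= absc z.
Proof. exact: le_trans (ler_norm _) (normRe_le_absc z). Qed.

Lemma normIm_le_absc z : `|complex.Im z| <= absc z.
Proof.
have := normRe_le_absc (z * 'i%C); rewrite ReiNIm normrN abscM.
suff -> : absc 'i%C = 1 by rewrite mulr1.
by apply: (@complexI R); rewrite absc_norm normc_def /= expr0n /= add0r expr1n sqrtr1.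
Qed.

Lemma ReD (x y : C) : complex.Re (x + y) = complex.Re x + complex.Re y.
Proof. exact: raddfD. Qed.

Lemma ReB (x y : C) : complex.Re (x - y) = complex.Re x - complex.Re y.
Proof. exact: raddfB. Qed.

Lemma Re_mul_real (x : R) z : complex.Re (real_complex R x * z) = x * complex.Re z.
Proof. by case: z => a b /=; rewrite mul0r subr0. Qed.

Definition dominated m n (A : 'M[C]_(m, n)) (B : 'M[R]_(m, n)) :=
  forall i j, absc (A i j) <= B i j.

Lemma dominated_ge0 m n (A : 'M_(m, n)) B i j : dominated A B -> 0 <= B i j.
Proof. by move=> dAB; apply: le_trans (absc_ge0 _) (dAB i j). Qed.

Lemma dominated_toC m n (B : 'M[R]_(m, n)) :
  (forall i j, 0 <= B i j) -> dominated (toC B) B.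
Proof. by move=> B0 i j; rewrite mxE absc_real ger0_norm. Qed.

Lemma dominatedD m n (A A' : 'M_(m, n)) B B' :
  dominated A B -> dominated A' B' -> dominated (A + A') (B + B').
Proof.
move=> dA dA' i j; rewrite !mxE.
by apply: le_trans (ler_abscD _ _) _; rewrite lerD.
Qed.

Lemma dominatedM m n p (A : 'M_(m, n)) (A' : 'M_(n, p)) B B' :
  dominated A B -> dominated A' B' -> dominated (A *m A') (B *m B').
Proof.
move=> dA dA' i j; rewrite !mxE; apply: le_trans (ler_absc_sum _ _ _) _.
by apply: ler_sum => k _; rewrite abscM ler_pM ?absc_ge0.
Qed.

Lemma dominatedZ m n (a : R) (A : 'M_(m, n)) B : 0 <= a ->
  dominated A B -> dominated (real_complex R a *: A) (a *: B).
Proof.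
by move=> a0 dA i j; rewrite !mxE abscM absc_real ger0_norm // ler_wpM2l.
Qed.

End Modulus.

(** * Comparison principle for M-matrices *)

Section MMatrix.
Variable R : realType.
Local Notation C := R[i].
Variables (n : nat) (A : 'M[C]_n) (B : 'M[R]_n) (w : 'I_n -> R).
Hypothesis w_gt0 : forall i, 0 < w i.
Hypothesis Bw_gt0 : forall i, 0 < \sum_j B i j * w j.
Hypothesis diagAB : forall i, B i i <= absc (A i i).
Hypothesis offAB : forall i j, i != j -> absc (A i j) <= - B i j.

(* Evaluate B (y - |z|) at an index minimising (y - |z|) / w. *)
Lemma Mmatrix_compare (z : 'cV[C]_n) (y : 'cV[R]_n) :
  dominated (A *m z) (B *m y) -> dominated z y.
Proof.
move=> dAz i0 j0; rewrite (ord1 j0) {j0}.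
pose u i := y i 0 - absc (z i 0).
pose i := [arg min_(i < i0) (u i / w i)]%O.
have imin j : u i / w i <= u j / w j.
  by rewrite /i; case: arg_minP => // k _; apply.
rewrite -subr_ge0 -/(u i0).
suff ui : 0 <= u i / w i.
  have := le_trans ui (imin i0); by rewrite pmulr_lge0 // invr_gt0.
rewrite leNgt; apply/negP => ui.
(* Row [i] reads [B y >= |A z| >= |A i i| |z i| - sum of |A i j| |z j| >= B |z|]. *)
have Bu : 0 <= \sum_j B i j * u j.
  have := dAz i 0; rewrite !mxE => dAzi.
  have -> : \sum_j B i j * u j =
      \sum_j B i j * y j 0 - \sum_j B i j * absc (z j 0).
    by rewrite -sumrB; apply: eq_bigr => j _; rewrite /u mulrBr.
  rewrite subr_ge0; apply: le_trans dAzi.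
  rewrite (bigD1 i) //= [X in _ <= absc X](bigD1 i) //=.
  set a := A i i * _; set b := (\sum_(j | _) A i j * _).
  have ab : absc a <= absc (a + b) + absc b.
    by have := ler_abscD (a + b) (- b); rewrite addrK abscN.
  have bb : absc b <= - \sum_(j | j != i) B i j * absc (z j 0).
    apply: le_trans (ler_absc_sum _ _ _) _; rewrite -sumrN ler_sum // => j ji.
    by rewrite abscM -mulNr ler_wpM2r ?absc_ge0 // offAB // eq_sym.
  have aa : B i i * absc (z i 0) <= absc a.
    by rewrite /a abscM ler_wpM2r ?absc_ge0.
  lra.
(* Minimality gives [u j >= (u i / w i) * w j], and the off-diagonal entries of [B] are
   non-positive. The right side is then a negative number times a positive one, against [Bu]. *)
have : \sum_j B i j * u j <= (u i / w i) * \sum_j B i j * w j.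
  rewrite mulr_sumr ler_sum // => j _.
  have [->|ji] := eqVneq j i.
    by rewrite mulrCA divfK ?gt_eqF.
  have uj : u i / w i * w j <= u j by rewrite -ler_pdivlMr.
  have Bij : 0 <= - B i j.
    by apply: le_trans (absc_ge0 _) (offAB _); rewrite eq_sym.
  nra.
have := Bw_gt0 i; nra.
Qed.

(** If [A z = 0], comparison with [y = 0] gives [|z| <= 0]. The transposes turn the row kernel
    [kermx] into column vectors. *)
Lemma Mmatrix_unit : A \in unitmx.
Proof.
rewrite -unitmx_tr -row_free_unit -kermx_eq0; apply/eqP/row_matrixP => i.
rewrite row0; set x := row i _.
have xA : A *m x^T = 0.
  apply: trmx_inj; rewrite trmx_mul trmxK trmx0 /x -row_mul.
  by rewrite mulmx_ker row0.
apply: trmx_inj; rewrite trmx0; apply/matrixP => k l.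
have /(_ k l) : dominated x^T (0 : 'cV[R]_n).
  by apply: Mmatrix_compare; rewrite xA mulmx0 => ? ?; rewrite !mxE absc0.
rewrite [X in _ <= X]mxE => x0; apply/eqP; rewrite [X in _ == X]mxE -absc_eq0.
by rewrite eq_le x0 absc_ge0.
Qed.

End MMatrix.

Section MMatrixInverse.
Variable R : realType.
Local Notation C := R[i].
Variables (n : nat) (B : 'M[R]_n) (w : 'I_n -> R).
Hypothesis w_gt0 : forall i, 0 < w i.
Hypothesis Bw_gt0 : forall i, 0 < \sum_j B i j * w j.
Hypothesis offB : forall i j, i != j -> B i j <= 0.

Lemma Mmatrix_real_unit : B \in unitmx.
Proof.
rewrite -(map_unitmx (real_complex R)); apply: (Mmatrix_unit w_gt0 Bw_gt0).
  by move=> i; rewrite mxE absc_real ler_norm.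
by move=> i j ij; rewrite mxE absc_real ler0_norm ?offB.
Qed.

Variable A : 'M[C]_n.
Hypothesis diagAB : forall i, B i i <= absc (A i i).
Hypothesis offAB : forall i j, i != j -> absc (A i j) <= - B i j.

(** Comparison column by column: [A] and [B] send the [j]-th columns of their inverses to the same
    basis vector. *)
Lemma Mmatrix_inv_dominated : dominated (invmx A) (invmx B).
Proof.
have UA := Mmatrix_unit w_gt0 Bw_gt0 diagAB offAB.
move=> i j; have := @Mmatrix_compare _ _ A B w w_gt0 Bw_gt0 diagAB offAB
  (col j (invmx A)) (col j (invmx B)) _ i 0.
rewrite [X in absc X <= _]mxE [X in _ <= X]mxE; apply.
rewrite !colE !mulmxA mulmxV // mulmxV ?Mmatrix_real_unit // !mul1mx.
move=> k l; rewrite !mxE.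
by rewrite -(rmorph_nat (real_complex R)) absc_real ger0_norm // ler0n.
Qed.

End MMatrixInverse.

(** * Limits of scalar and matrix sequences *)

Section Limits.

(** Over [R[i]] the condition [0 < eps] forces [eps] to be real, so one definition serves real and
    complex sequences. *)
Definition scvg (K : numFieldType) (u : nat -> K) (l : K) :=
  forall eps, 0 < eps -> exists n0, forall n, (n0 <= n)%N -> `|u n - l| <= eps.

Variable K : numFieldType.
Implicit Types (u v : nat -> K) (l : K).

Lemma scvg_cst l : scvg (fun=> l) l.
Proof. by move=> eps /ltW e0; exists 0%N => n _; rewrite subrr normr0. Qed.

Lemma scvgD u v l l' : scvg u l -> scvg v l' -> scvg (fun n => u n + v n) (l + l').
Proof.
move=> ul vl' eps e0.
have e2 : 0 < eps / 2%:R by rewrite divr_gt0 // ltr0n.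
have [n1 h1] := ul _ e2; have [n2 h2] := vl' _ e2.
exists (maxn n1 n2) => n; rewrite geq_max => /andP[/h1 le1 /h2 le2].
rewrite (_ : _ - _ = (u n - l) + (v n - l')); last by ring.
apply: le_trans (ler_normD _ _) _; rewrite [leRHS](_ : _ = eps / 2%:R + eps / 2%:R).
  exact: lerD.
by field.
Qed.

Lemma scvgM u v l l' : scvg u l -> scvg v l' -> scvg (fun n => u n * v n) (l * l').
Proof.
move=> ul vl' eps e0.
(* [M] bounds [|l|] and, once [v n] is within distance 1 of [l'], also [|v n|]. *)
pose M := 1 + `|l| + `|l'|.
have M1 : 1 <= M by rewrite /M -addrA lerDl addr_ge0.
have M0 : 0 < M by apply: lt_le_trans M1.
have e2 : 0 < eps / (2%:R * M) by rewrite divr_gt0 // mulr_gt0 // ltr0n.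
have [n1 h1] := ul _ e2; have [n2 h2] := vl' _ e2; have [n3 h3] := vl' _ ltr01.
exists (maxn n1 (maxn n2 n3)) => n.
rewrite !geq_max => /and3P[/h1 le1 /h2 le2 /h3 le3].
have vM : `|v n| <= M.
  rewrite -(subrK l' (v n)); apply: le_trans (ler_normD _ _) _.
  by apply: le_trans (lerD le3 (lexx _)) _; rewrite /M -addrA lerD2l lerDr.
have lM : `|l| <= M by rewrite /M (addrC 1) -addrA lerDl addr_ge0.
rewrite (_ : _ - _ = (u n - l) * v n + l * (v n - l')); last by ring.
apply: le_trans (ler_normD _ _) _; rewrite !normrM.
rewrite [leRHS](_ : _ = eps / (2%:R * M) * M + M * (eps / (2%:R * M))).
  by apply: lerD; apply: ler_pM.
by field; rewrite gt_eqF.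
Qed.

Lemma scvg_sum (I : finType) (u : I -> nat -> K) (l : I -> K) :
  (forall i, scvg (u i) (l i)) -> scvg (fun n => \sum_i u i n) (\sum_i l i).
Proof.
move=> ul; suff H r : scvg (fun n => \sum_(i <- r) u i n) (\sum_(i <- r) l i).
  by apply: H.
elim: r => [|i r IHr].
  move=> eps e0; exists 0%N => n _; rewrite !big_nil subrr normr0; exact: ltW.
move=> eps e0; have [n0 h0] := scvgD (ul i) IHr e0.
by exists n0 => n /h0; rewrite !big_cons.
Qed.

Lemma scvgS u l : scvg u l -> scvg (fun n => u n.+1) l.
Proof. by move=> ul eps /ul[n0 h]; exists n0 => n n0n; apply/h/leqW. Qed.

Lemma scvg_unique u l l' : scvg u l -> scvg u l' -> l = l'.
Proof.
move=> ul ul'; apply/eqP; rewrite -subr_eq0 -normr_eq0.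
apply/negPn/negP => nz; have d0 : 0 < `|l - l'| by rewrite lt_def nz normr_ge0.
have e0 : 0 < `|l - l'| / 4%:R by rewrite divr_gt0 // ltr0n.
have [n1 /(_ _ (leq_maxl _ _)) h1] := ul _ e0.
have [n2 h2] := ul' _ e0; have {h2} := h2 _ (leq_maxr n1 n2).
move/(fun e => lerD (h1 n2) e); rewrite (distrC _ l) => le1.
have le2 : `|l - l'| <= `|l - u (maxn n1 n2)| + `|u (maxn n1 n2) - l'|.
  exact: ler_distD.
have := le_trans le2 le1; rewrite (_ : _ / _ + _ / _ = `|l - l'| / 2%:R); last by field.
rewrite ler_pdivlMr ?ltr0n // mulr_natr mulr2n gerDl; apply/negP.
by rewrite -real_ltNge ?real0 ?normr_real.
Qed.

Definition scvgm m n (u : nat -> 'M[K]_(m, n)) (l : 'M[K]_(m, n)) :=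
  forall i j, scvg (fun k => u k i j) (l i j).

Lemma scvg_ext u v l : (forall n, u n = v n) -> scvg u l -> scvg v l.
Proof. by move=> uv ul eps /ul[n0 h]; exists n0 => n /h; rewrite uv. Qed.

Lemma scvgm_mul m n p (u : nat -> 'M[K]_(m, n)) (v : nat -> 'M[K]_(n, p))
    (l : 'M_(m, n)) (l' : 'M_(n, p)) :
  scvgm u l -> scvgm v l' -> scvgm (fun k => u k *m v k) (l *m l').
Proof.
move=> ul vl' i j; rewrite mxE.
apply: (scvg_ext (u := fun k => \sum_q u k i q * v k q j)).
  by move=> k; rewrite mxE.
by apply: scvg_sum => q; apply: scvgM.
Qed.

End Limits.

Section RealLimits.
Variable R : realType.
Local Notation C := R[i].
Implicit Types (u a : nat -> R).

Lemma nondecreasing_scvg u (M : R) :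
  (forall n, u n <= u n.+1) -> (forall n, u n <= M) -> exists l, scvg u l.
Proof.
move=> uS uM; pose S := range u.
have homo m n : (m <= n)%N -> u m <= u n.
  move/subnKC <-; elim: (n - m)%N => [|k IHk]; first by rewrite addn0.
  by rewrite addnS (le_trans IHk).
have hs : has_sup S.
  split; first by exists (u 0%N); exists 0%N.
  by exists M => _ [n _ <-].
exists (sup S) => eps e0.
have [_ [n0 _ <-] hn0] := sup_adherent e0 hs.
exists n0 => n /homo le_n.
have le_s : u n <= sup S by apply: sup_upper_bound => //; exists n.
by rewrite distrC ger0_norm ?subr_ge0 // lerBlDr -lerBlDl ltW // (lt_le_trans hn0).
Qed.

Lemma scvg_le u l (M : R) : scvg u l -> (forall n, u n <= M) -> l <= M.
Proof.
move=> ul uM; apply/ler_addgt0Pr => e /ul[n /(_ n (leqnn n))].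
by rewrite ler_norml => /andP[le1 _]; have := uM n; lra.
Qed.

(** Both [a] and [u + a] are non-decreasing and bounded above, and [u] is their difference. *)
Lemma dominated_increments_scvg u a (M : R) :
  (forall n, `|u n.+1 - u n| <= a n.+1 - a n) ->
  (forall n, a n <= M) -> exists l, scvg u l.
Proof.
move=> ua aM.
have aS n : a n <= a n.+1 by rewrite -subr_ge0; apply: le_trans (ua n).
have u0 n : u n <= u 0%N + a n - a 0%N.
  elim: n => [|n IHn]; first by lra.
  by have := ua n; rewrite ler_norml => /andP[]; lra.
have [l1 cl1] : exists l, scvg (fun n => u n + a n) l.
  apply: (@nondecreasing_scvg _ (u 0%N + M + M - a 0%N)) => n.
    by have := ua n; rewrite ler_norml => /andP[]; lra.
  by have := u0 n; have := aM n; lra.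
have [l2 cl2] := nondecreasing_scvg aS aM.
exists (l1 + (-1) * l2); apply: scvg_ext (scvgD cl1 (scvgM (@scvg_cst _ (-1)) cl2)).
by move=> n /=; ring.
Qed.

Lemma scvg_real_complex u l :
  scvg u l -> scvg (fun n => real_complex R (u n)) (real_complex R l).
Proof.
move=> ul eps e0; have er : eps = real_complex R (complex.Re eps).
  by rewrite RRe_real // gtr0_real.
have /ul[n0 h] : 0 < complex.Re eps by rewrite -ltcRR -er.
by exists n0 => n /h; rewrite -rmorphB /= er -absc_norm absc_real lecRR.
Qed.

(** The real and imaginary parts have increments no larger than the modulus, so the real case
    applies to each. *)
Lemma dominated_increments_scvgC (u : nat -> C) a (M : R) :
  (forall n, absc (u n.+1 - u n) <= a n.+1 - a n) ->
  (forall n, a n <= M) -> exists l, scvg u l.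
Proof.
move=> ua aM.
have [l1 /scvg_real_complex cl1] : exists l, scvg (fun n => complex.Re (u n)) l.
  apply: (@dominated_increments_scvg _ a M) => // n.
  by rewrite -raddfB; apply: le_trans (normRe_le_absc _) (ua n).
have [l2 /scvg_real_complex cl2] : exists l, scvg (fun n => complex.Im (u n)) l.
  apply: (@dominated_increments_scvg _ a M) => // n.
  by rewrite -raddfB; apply: le_trans (normIm_le_absc _) (ua n).
eexists; apply: scvg_ext (scvgD cl1 (scvgM (@scvg_cst _ 'i%C) cl2)).
by move=> n /=; rewrite -complexE.
Qed.

Lemma absc_scvg_le (u : nat -> C) a l la :
  scvg u l -> scvg a la -> (forall n, absc (u n) <= a n) -> absc l <= la.
Proof.
move=> ul al ua; apply/ler_addgt0Pr => e e0.
have e2 : 0 < e / 2%:R by rewrite divr_gt0.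
have e2' : 0 < real_complex R (e / 2%:R) by rewrite (ltcRR 0).
have [n1 /(_ _ (leq_maxl _ _)) h1] := ul _ e2'.
have [n2 h2] := al _ e2; have {h2} := h2 _ (leq_maxr n1 n2).
move: {h1} (h1 n2); set n := maxn _ _; rewrite -absc_norm lecRR => h1.
rewrite ler_norml => /andP[_ h2].
have := ler_abscD (u n) (l - u n); rewrite addrC subrK (abscB l).
by have := ua n; lra.
Qed.

End RealLimits.

(** * Fixed-point iteration and its real majorant *)

Lemma mxBE (V : zmodType) m n (A B : 'M[V]_(m, n)) i j :
  (A - B) i j = A i j - B i j.
Proof. by rewrite !mxE. Qed.

Section Iteration.
Variables (N m : nat) (e : 'I_m -> 'I_N).

Section Step.
Variable K : numFieldType.
Implicit Types (F : 'M[K]_(N, m)).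

(** [F] packs both unknowns: its rows in [codom e] carry [G] minus the diagonal [d], the other rows
    are the free rows of [W]. *)
Definition selW F : 'M[K]_(N, m) :=
  \matrix_(k, j) if k \in codom e then (k == e j)%:R else F k j.

Definition genG (d : 'I_N -> K) F : 'M[K]_m :=
  \matrix_(i, j) (d (e i) *+ (i == j) + F (e i) j).

(** This is the factor [r - s G] on the selected rows, with [t = s], and [r - G] on the others, with
    [t = 1]. *)
Definition pencil (t d r : 'I_N -> K) F k : 'M[K]_m :=
  (r k)%:M - t k *: genG d F.

(** Solves [F_k (r_k - t_k G) = c_k W] for a new row [F_k], with [G] and [W] built from the old
    [F]. *)
Definition step (c : 'M[K]_N) (t d r : 'I_N -> K) F : 'M[K]_(N, m) :=
  \matrix_k (row k c *m selW F *m invmx (pencil t d r F k)).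

Lemma stepE c t d r F k j : step c t d r F k j =
  (row k c *m selW F *m invmx (pencil t d r F k)) 0 j.
Proof. by rewrite mxE. Qed.

Lemma stepBE c t d r F F' k j : (step c t d r F' - step c t d r F) k j =
  (row k c *m selW F' *m invmx (pencil t d r F' k)
   - row k c *m selW F *m invmx (pencil t d r F k)) 0 j.
Proof.
rewrite 2!mxBE; congr (_ - _); exact: stepE.
Qed.

Definition step_fixed (c : 'M[K]_N) (t d r : 'I_N -> K) F :=
  forall k, row k F *m pencil t d r F k = row k c *m selW F.

(** Each step is multiplied out by its pencil, so that only limits of sums and products are
    taken. *)
Lemma scvgm_fixed c t d r (F : nat -> 'M[K]_(N, m)) L :
  (forall n, F n.+1 = step c t d r (F n)) ->
  (forall n k, pencil t d r (F n) k \in unitmx) ->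
  scvgm F L -> step_fixed c t d r L.
Proof.
move=> FS U FL k.
have cG : scvgm (fun n => pencil t d r (F n) k) (pencil t d r L k).
  move=> i j; rewrite /pencil !mxE.
  apply: (@scvg_ext _ (fun n => (r k *+ (i == j) - t k * (d (e i) *+ (i == j)))
      + (- t k) * F n (e i) j)).
    by move=> n; rewrite !mxE; ring.
  have -> : r k *+ (i == j) - t k * (d (e i) *+ (i == j) + L (e i) j)
    = (r k *+ (i == j) - t k * (d (e i) *+ (i == j))) + (- t k) * L (e i) j by ring.
  by apply: scvgD; [exact: scvg_cst | apply: scvgM; [exact: scvg_cst |]].
have cW : scvgm (fun n => selW (F n)) (selW L).
  move=> i j; rewrite mxE; case: ifP => ie; last first.
    by apply: scvg_ext (FL i j) => n; rewrite mxE ie.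
  by apply: scvg_ext (@scvg_cst _ _) => n; rewrite mxE ie.
have cr : scvgm (fun n => row k (F n.+1)) (row k L).
  by move=> i j; rewrite mxE; apply: scvg_ext (scvgS (FL k j)) => n; rewrite mxE.
have cc : scvgm (fun=> row k c) (row k c) by move=> i j; apply: scvg_cst.
apply/matrixP => i j.
apply: scvg_unique (scvgm_mul cr cG i j) _.
apply: scvg_ext (scvgm_mul cc cW i j) => n /=.
by rewrite FS rowK mulmxKV.
Qed.

End Step.

Variable R : realType.
Local Notation C := R[i].
Local Notation toCf f := (fun k => real_complex R (f k)).
Variables (c : 'M[R]_N) (t dR rR : 'I_N -> R) (d r : 'I_N -> C).

(** Row-sum bound for the real iterates: [- dR k] on a selected row makes the row sum of
    [genG dR FR] non-positive, and [1] on any other row makes that row of [W] sub-stochastic. *)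
Definition bnd k : R := if k \in codom e then - dR k else 1.

Hypothesis e_inj : injective e.
Hypothesis c_ge0 : forall i j, 0 <= c i j.
Hypothesis t_ge0 : forall k, 0 <= t k.
Hypothesis rR_gt0 : forall k, 0 < rR k.
Hypothesis d_le : forall k, complex.Re (d k) <= dR k.
Hypothesis r_ge : forall k, rR k <= complex.Re (r k).
Hypothesis c_sum : forall k, \sum_j c k j <= bnd k * rR k.

Definition rowsum_ok (FR : 'M[R]_(N, m)) := forall k, \sum_j FR k j <= bnd k.

Implicit Types (F : 'M[C]_(N, m)) (FR : 'M[R]_(N, m)).

Local Notation penC := (pencil (toCf t) d r).
Local Notation penR := (pencil t dR rR).
Local Notation stepC := (step (toC c) (toCf t) d r).
Local Notation stepR := (step c t dR rR).

Lemma selW_dominated F FR : dominated F FR -> dominated (selW F) (selW FR).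
Proof.
move=> dF k j; rewrite !mxE; case: ifP => // _.
by rewrite -(rmorph_nat (real_complex R)) absc_real ger0_norm // ler0n.
Qed.

Lemma selW_dominatedB F FR F' FR' : dominated (F' - F) (FR' - FR) ->
  dominated (selW F' - selW F) (selW FR' - selW FR).
Proof.
move=> dF k j; move: (dF k j); rewrite !mxE.
by case: ifP => // _; rewrite !subrr absc0.
Qed.

Lemma genG_dominatedB F FR F' FR' : dominated (F' - F) (FR' - FR) ->
  dominated (genG d F' - genG d F) (genG dR FR' - genG dR FR).
Proof.
move=> dF i j; move: (dF (e i) j); rewrite !mxE.
by rewrite !opprD !addrA !(addrAC _ _ (- (_ *+ _))) !subrr !add0r.
Qed.

Section Pencil.
Variables (F : 'M[C]_(N, m)) (FR : 'M[R]_(N, m)).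
Hypotheses (dF : dominated F FR) (sF : rowsum_ok FR).

Lemma genG_sum_le0 i : \sum_j genG dR FR i j <= 0.
Proof.
under eq_bigr do rewrite mxE.
rewrite big_split /= (bigD1 i) //= eqxx big1 ?addr0; last first.
  by move=> j; rewrite eq_sym => /negPf ->.
by have := sF (e i); rewrite /bnd codom_f mulr1n; lra.
Qed.

(* The resolvent comparison behind both the iteration and the location of
   the spectrum: [genG d F] is dominated by the sub-generator [genG dR FR]. *)
Section Resolvent.
Variables (a : C) (aR tk : R).
Hypotheses (tk0 : 0 <= tk) (aR0 : 0 < aR) (aRa : aR <= complex.Re a).
Let A : 'M[C]_m := a%:M - real_complex R tk *: genG d F.
Let B : 'M[R]_m := aR%:M - tk *: genG dR FR.

(** Makes the constant vector 1 the positive weight for the comparison principle; the row sums of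
    [genG dR FR] are non-positive. *)
Lemma resolvent_sum i : aR <= \sum_j B i j * 1.
Proof.
rewrite (eq_bigr (fun j => aR *+ (i == j) - tk * genG dR FR i j)); last first.
  by move=> j _; rewrite mulr1 !mxE.
rewrite sumrB -mulr_sumr [X in X - _](bigD1 i) //= eqxx big1 ?addr0.
  by rewrite mulr1n lerDl oppr_ge0 mulr_ge0_le0 ?genG_sum_le0.
by move=> j; rewrite eq_sym => /negPf ->.
Qed.

Lemma resolvent_gt0 i : 0 < \sum_j B i j * 1.
Proof. exact: lt_le_trans (resolvent_sum i). Qed.

Lemma resolvent_diag i : B i i <= absc (A i i).
Proof.
apply: le_trans (Re_le_absc _); rewrite !mxE eqxx !mulr1n.
rewrite ReB Re_mul_real ReD.
apply: lerB => //; rewrite ler_wpM2l // lerD //.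
exact: le_trans (Re_le_absc _) (dF (e i) i).
Qed.

Lemma resolvent_off i j : i != j -> absc (A i j) <= - B i j.
Proof.
move=> /negPf ij; rewrite !mxE ij !mulr0n !add0r opprK abscN abscM absc_real.
by rewrite ger0_norm // ler_wpM2l.
Qed.

Lemma resolvent_offR i j : i != j -> B i j <= 0.
Proof.
move=> /negPf ij; rewrite !mxE ij !mulr0n !add0r oppr_le0 mulr_ge0 //.
exact: dominated_ge0 dF.
Qed.

Lemma resolvent_unit : A \in unitmx.
Proof.
exact: (@Mmatrix_unit _ _ _ B (fun=> 1) _ resolvent_gt0 resolvent_diag resolvent_off).
Qed.

Lemma resolvent_unitR : B \in unitmx.
Proof.
exact: (@Mmatrix_real_unit _ _ B (fun=> 1) _ resolvent_gt0 resolvent_offR).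
Qed.

Lemma resolvent_dominated : dominated (invmx A) (invmx B).
Proof.
exact: (@Mmatrix_inv_dominated _ _ B (fun=> 1) _ resolvent_gt0 resolvent_offR _
  resolvent_diag resolvent_off).
Qed.

(** [B] sends the constant vector [aR^-1] above 1, so comparison bounds the solution [invmx B *m 1]
    of [B x = 1] by that constant. *)
Lemma resolvent_inv_sum i : \sum_j invmx B i j <= aR^-1.
Proof.
have h : dominated (toC B *m toC (invmx B *m const_mx 1 : 'cV[R]_m)) (B *m const_mx aR^-1).
  rewrite -map_mxM mulmxA mulmxV ?resolvent_unitR // mul1mx => k l.
  rewrite !mxE absc_real normr1 (eq_bigr (fun j => aR^-1 * (B k j * 1))).
    by rewrite -mulr_sumr mulrC ler_pdivlMr // mul1r resolvent_sum.
  by move=> j _; rewrite [const_mx _ _ _]mxE mulr1 mulrC.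
have := @Mmatrix_compare _ _ (toC B) B (fun=> 1) _ resolvent_gt0 _ _ _ _ h i 0.
rewrite !mxE absc_real => le1.
rewrite (eq_bigr (fun j => invmx B i j * (const_mx 1 : 'cV[R]_m) j 0)); last first.
  by move=> j _; rewrite [const_mx _ _ _]mxE mulr1.
apply: le_trans (ler_norm _) (le1 _ _ _) => //.
  by move=> k; rewrite [toC _ _ _]mxE absc_real ler_norm.
by move=> k l kl; rewrite [toC _ _ _]mxE absc_real ler0_norm ?resolvent_offR.
Qed.

End Resolvent.

Lemma step_dominated : dominated (stepC F) (stepR FR).
Proof.
move=> k j.
suff : dominated (row k (toC c) *m selW F *m invmx (penC F k))
                 (row k c *m selW FR *m invmx (penR FR k)).
  by move/(_ 0 j); rewrite !stepE.
apply: dominatedM; last exact: resolvent_dominated.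
by apply: dominatedM (selW_dominated dF) => i l; rewrite !mxE absc_real ger0_norm.
Qed.

Lemma selW_sum_le1 k : \sum_j selW FR k j <= 1.
Proof.
have [/codomP[i ->]|/negPf ke] := boolP (k \in codom e).
  rewrite (bigD1 i) //= mxE codom_f eqxx big1 ?addr0 // => j /negPf ji.
  by rewrite mxE codom_f (inj_eq e_inj) eq_sym ji.
by have := sF k; rewrite /bnd ke; under [X in _ -> X <= _]eq_bigr do rewrite mxE ke.
Qed.

(** The inverse pencil has row sums at most [(rR k)^-1] and [selW FR] has row sums at most 1, so
    [c_sum] returns exactly the bound [bnd k]. *)
Lemma step_rowsum : rowsum_ok (stepR FR).
Proof.
move=> k; set X := invmx (penR FR k).
have X1 i : \sum_j X i j <= (rR k)^-1 by apply: (resolvent_inv_sum (t_ge0 k) (rR_gt0 k)).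
have -> : \sum_j stepR FR k j = \sum_p c k p * \sum_l selW FR p l * \sum_j X l j.
  transitivity (\sum_j \sum_l \sum_p c k p * selW FR p l * X l j).
    apply: eq_bigr => j _; rewrite stepE mxE; apply: eq_bigr => l _.
    rewrite mxE mulr_suml; apply: eq_bigr => q _; by rewrite mxE.
  rewrite exchange_big /= [RHS](eq_bigr
    (fun p => \sum_l \sum_j c k p * selW FR p l * X l j)).
    by rewrite [RHS]exchange_big /=; apply: eq_bigr => l _; rewrite exchange_big.
  move=> q _; rewrite mulr_sumr; apply: eq_bigr => l _.
  by rewrite mulrA mulr_sumr.
apply: le_trans (_ : \sum_p c k p * (rR k)^-1 <= _); last first.
  by rewrite -mulr_suml ler_pdivrMr // c_sum.
apply: ler_sum => q _; rewrite ler_wpM2l //.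
apply: le_trans (_ : \sum_l selW FR q l * (rR k)^-1 <= _).
  by apply: ler_sum => l _; rewrite ler_wpM2l // (dominated_ge0 _ _ (selW_dominated dF)).
by rewrite -mulr_suml ler_piMl ?invr_ge0 ?selW_sum_le1 // ltW.
Qed.

Lemma pencil_unit k : penC F k \in unitmx.
Proof. exact: (resolvent_unit (t_ge0 k) (rR_gt0 k) (r_ge k)). Qed.

Lemma pencil_unitR k : penR FR k \in unitmx.
Proof. exact: (resolvent_unitR (t_ge0 k) (rR_gt0 k)). Qed.

End Pencil.

(** Product rule with the resolvent identity: the difference becomes a sum of products whose factors
    can be dominated one at a time. *)
Lemma mul_inv_diff (K : comUnitRingType) p n (x x' : 'M[K]_(p, n)) (A A' : 'M[K]_n) :
  A \in unitmx -> A' \in unitmx ->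
  x' *m invmx A' - x *m invmx A
  = (x' - x) *m invmx A' + x *m (invmx A' *m (A - A') *m invmx A).
Proof.
move=> UA UA'.
have -> : invmx A' *m (A - A') *m invmx A = invmx A' - invmx A.
  by rewrite mulmxBr mulmxBl mulVmx // mul1mx -mulmxA mulmxV // mulmx1.
by rewrite mulmxBl mulmxBr addrA subrK.
Qed.

Lemma step_dominatedB F FR F' FR' :
  dominated F FR -> rowsum_ok FR -> dominated F' FR' -> rowsum_ok FR' ->
  dominated (F' - F) (FR' - FR) ->
  dominated (stepC F' - stepC F) (stepR FR' - stepR FR).
Proof.
move=> dF sF dF' sF' dFF k j.
have ck : dominated (row k (toC c)) (row k c).
  by move=> i l; rewrite !mxE absc_real ger0_norm.
suff : dominated (row k (toC c) *m selW F' *m invmx (penC F' k) -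
                  row k (toC c) *m selW F *m invmx (penC F k))
                 (row k c *m selW FR' *m invmx (penR FR' k) -
                  row k c *m selW FR *m invmx (penR FR k)).
  by move/(_ 0 j); rewrite [X in _ -> absc X <= _]stepBE [X in _ -> _ <= X]stepBE.
rewrite (mul_inv_diff _ _ (pencil_unit dF sF k) (pencil_unit dF' sF' k)).
rewrite (mul_inv_diff _ _ (pencil_unitR dF sF k) (pencil_unitR dF' sF' k)).
rewrite -!mulmxBr; apply: dominatedD.
  apply: dominatedM; last exact: (resolvent_dominated dF' sF').
  by apply: dominatedM => //; apply: selW_dominatedB.
apply: dominatedM; first by apply: dominatedM => //; apply: selW_dominated.
apply: dominatedM; last exact: (resolvent_dominated dF sF).
apply: dominatedM; first exact: (resolvent_dominated dF' sF').
(* In this order the difference of pencils is a non-negative multiple of the increment of [genG],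
   which is dominated by assumption. *)
have pB (K : numFieldType) (tt dd rr : 'I_N -> K) G G' :
    pencil tt dd rr G k - pencil tt dd rr G' k = tt k *: (genG dd G' - genG dd G).
  by rewrite /pencil opprB addrC addrA subrK scalerBr.
by rewrite !pB; apply: dominatedZ => //; apply: genG_dominatedB.
Qed.

Definition seqC n : 'M[C]_(N, m) := iter n stepC 0.
Definition seqR n : 'M[R]_(N, m) := iter n stepR 0.

Lemma bnd_ge0 k : 0 <= bnd k.
Proof.
rewrite -(pmulr_lge0 _ (rR_gt0 k)); apply: le_trans (c_sum k).
by apply: sumr_ge0 => j _.
Qed.

(** The three claims go together: domination and the row-sum bound supply the invertible pencils on
    which the comparison of increments rests. *)
Lemma seq_invariant n :
  [/\ dominated (seqC n) (seqR n), rowsum_ok (seqR n) &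
      dominated (seqC n.+1 - seqC n) (seqR n.+1 - seqR n)].
Proof.
have d0 : dominated (0 : 'M[C]_(N, m)) (0 : 'M[R]_(N, m)).
  by move=> i j; rewrite !mxE absc0.
have s0 : rowsum_ok 0.
  by move=> k; rewrite big1 ?bnd_ge0 // => j _; rewrite mxE.
elim: n => [|n [IH1 IH2 IH3]].
  by split=> //; rewrite !subr0; apply: step_dominated.
have d1 : dominated (seqC n.+1) (seqR n.+1) by apply: step_dominated.
have s1 : rowsum_ok (seqR n.+1) by apply: step_rowsum.
split; [exact: d1 | exact: s1 |].
exact: (@step_dominatedB (seqC n) (seqR n) (seqC n.+1) (seqR n.+1) IH1 IH2 d1 s1 IH3).
Qed.

Lemma step_fixed_exists : exists (L : 'M[C]_(N, m)) (LR : 'M[R]_(N, m)),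
  [/\ dominated L LR, rowsum_ok LR, step_fixed (toC c) (toCf t) d r L
    & step_fixed c t dR rR LR].
Proof.
have inv := seq_invariant.
have seqR_le n k j : seqR n k j <= bnd k.
  have [d0 s0 _] := inv n; apply: le_trans (s0 k).
  by rewrite (bigD1 j) //= lerDl sumr_ge0 // => l _; apply: dominated_ge0 d0.
(* The increments of [seqR] dominate moduli, hence are non-negative: the sequence is monotone. *)
have [LR cLR] : exists LR, scvgm seqR LR.
  have lim k j : exists l, scvg (fun n => seqR n k j) l.
    apply: (nondecreasing_scvg (M := bnd k)) => // n.
    have [_ _ d3] := inv n; have := dominated_ge0 k j d3.
    by rewrite mxBE subr_ge0.
  have [f cf] := fin_all_exists (fun k => fin_all_exists (lim k)).
  by exists (\matrix_(k, j) f k j) => k j; rewrite mxE.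
have [L cL] : exists L, scvgm seqC L.
  have lim k j : exists l, scvg (fun n => seqC n k j) l.
    apply: (dominated_increments_scvgC (a := fun n => seqR n k j) (M := bnd k)) => // n.
    by have [_ _ /(_ k j)] := inv n; rewrite 2!mxBE.
  have [f cf] := fin_all_exists (fun k => fin_all_exists (lim k)).
  by exists (\matrix_(k, j) f k j) => k j; rewrite mxE.
exists L, LR; split.
- move=> k j; apply: absc_scvg_le (cL k j) (cLR k j) _ => n.
  by have [/(_ k j)] := inv n.
- move=> k; apply: scvg_le (scvg_sum (fun j => cLR k j)) _ => n.
  by have [_ /(_ k)] := inv n.
- apply: (@scvgm_fixed _ _ _ _ _ seqC) => // n k.
  by have [d0 s0 _] := inv n; apply: pencil_unit s0 k.
apply: (@scvgm_fixed _ _ _ _ _ seqR) => // n k.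
by have [d0 s0 _] := inv n; apply: pencil_unitR d0 s0 k.
Qed.

End Iteration.

(** * Factoring the quadratic, and existence of one half of the factorisation *)

Lemma Re_sqrtC_ge (R : realType) (z : R[i]) (D : R) :
  0 <= D -> complex.Re z = D ->
  exists w : R[i], w * w = z /\ Num.sqrt D <= complex.Re w.
Proof.
move=> D0 zD.
have [w [ww w0]] : exists w : R[i], w * w = z /\ 0 <= complex.Re w.
  have sq : sqrtC z * sqrtC z = z by rewrite -expr2 sqrtCK.
  have [w0|/ltW w0] := leP 0 (complex.Re (sqrtC z)); first by exists (sqrtC z).
  by exists (- sqrtC z); rewrite mulrNN sq raddfN /= oppr_ge0.
exists w; split=> //; rewrite -(ger0_norm w0) -sqrtr_sqr ler_sqrt; last exact: sqr_ge0.
(* [Re (w * w) = x^2 - y^2 <= x^2]. *)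
rewrite -zD -ww; case: w {ww w0} => x y /=; rewrite expr2; nra.
Qed.

(* [d] and [r / s] are the roots of [s x^2 - v x - z] with negative and positive
   real part; when [s = 0] only the root [d] survives. *)
Lemma quadratic_split (R : realType) (s v : R) (z : R[i]) :
  0 <= s -> (s = 0 -> v = 1) -> 0 < complex.Re z ->
  exists (dR rR : R) (d r : R[i]),
    [/\ 0 < rR, complex.Re d <= dR & rR <= complex.Re r] /\
    [/\ rR + s * dR = v, dR * rR = - complex.Re z,
        r + s%:C%C * d = v%:C%C & d * r = - z].
Proof.
move=> s0 v1 a0; have [sz|sn] := eqVneq s 0.
  (* For [s = 0] and [v = 1] the polynomial is [- (x + z)], with root [d = - z] and constant factor
     [r = 1]. *)
  exists (- complex.Re z), 1, (- z), 1; split.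
    by split=> //; rewrite raddfN.
  by rewrite sz v1 // !mul0r !addr0 !mulr1.
have {v1} sp : 0 < s by rewrite lt_def sn.
set a := complex.Re z in a0 *.
(* [D] and [zD] are the discriminants for [Re z] and for [z]. As [Re zD = D], the root [w] of [zD]
   satisfies [sqrt D <= Re w], which yields both [Re d <= dR] and [rR <= Re r]. *)
pose D := v * v + 4%:R * s * a.
have vv : 0 <= v * v by rewrite -expr2 sqr_ge0.
have sa : 0 < s * a by rewrite mulr_gt0.
have D0 : 0 <= D by rewrite /D; nra.
pose zD : R[i] := (v * v)%:C%C + (4%:R * s)%:C%C * z.
have zDE : complex.Re zD = D by rewrite /zD ReD Re_mul_real.
have [w [ww wq]] := Re_sqrtC_ge D0 zDE.
set q := Num.sqrt D in wq.
have qq : q * q = D by rewrite -expr2 sqr_sqrtr.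
have q0 : 0 <= q by apply: sqrtr_ge0.
have vq : 0 < v + q.
  rewrite ltNge; apply/negP => vq; suff : D <= v * v by rewrite /D; nra.
  rewrite -qq; nra.
have s2 : 0 < (2%:R * s)^-1 by rewrite invr_gt0; nra.
have sC0 : s%:C%C != 0 :> R[i] by rewrite -(rmorph0 (real_complex R)) (inj_eq (@complexI R)).
(* [d] is the root [(v - w) / (2 s)], and [r = (v + w) / 2] is [s] times the other root. *)
exists ((2%:R * s)^-1 * (v - q)), (2%:R^-1 * (v + q)),
  (real_complex R (2%:R * s)^-1 * (v%:C%C - w)), (real_complex R 2%:R^-1 * (v%:C%C + w)).
split; [split|split].
- by rewrite mulr_gt0 // invr_gt0.
- by rewrite Re_mul_real ler_wpM2l ?(ltW s2) // ReB lerB.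
- by rewrite Re_mul_real ler_wpM2l ?invr_ge0 // ReD lerD.
- by field.
- transitivity ((v * v - q * q) / (4%:R * s)); first by field.
  by rewrite qq /D; field.
- rewrite !fmorphV rmorphM /= rmorph_nat; field.
  exact: sC0.
- transitivity ((v%:C%C * v%:C%C - w * w) / (4%:R * s%:C%C)).
    rewrite !fmorphV rmorphM /= rmorph_nat; field; exact: sC0.
  rewrite ww /zD !rmorphM /= rmorph_nat; field; exact: sC0.
Qed.

Section Existence.
Variables (R : realType) (N m : nat) (e : 'I_m -> 'I_N).
Local Notation C := R[i].
Local Notation toCf f := (fun k => real_complex R (f k)).
Variables (q : 'M[R]_N) (s v : 'I_N -> R) (h : 'rV[C]_N).

Definition wh_eq (W : 'M[C]_(N, m)) (G : 'M[C]_m) := forall k,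
  (s k)%:C%C *: (row k W *m G *m G) - (v k)%:C%C *: (row k W *m G)
    + row k (Qh q h) *m W = 0.

Hypothesis e_inj : injective e.
Hypothesis q_off : forall i j, i != j -> 0 <= q i j.
Hypothesis q_sum : forall i, \sum_j q i j <= 0.
Hypothesis h_ge0 : forall k, 0 <= complex.Re (h 0 k).
Hypothesis a_gt0 : forall k, 0 < complex.Re (h 0 k) - q k k.
Hypothesis s_ge0 : forall k, 0 <= s k.
Hypothesis up_rows : forall i, s (e i) = 0 -> v (e i) = 1.
Hypothesis down_rows : forall k, k \notin codom e -> s k = 0 /\ v k = -1.

Let c : 'M[R]_N := \matrix_(i, j) if i == j then 0 else q i j.

Lemma row_Qh_mul k (W : 'M[C]_(N, m)) :
  row k (Qh q h) *m W = row k (toC c) *m W + ((q k k)%:C%C - h 0 k) *: row k W.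
Proof.
have -> : row k (Qh q h) = row k (toC c) + ((q k k)%:C%C - h 0 k) *: delta_mx 0 k.
  apply/rowP => j; rewrite !mxE /=.
  have [->|kj] := eqVneq k j; first by rewrite mulr1 mulr1n add0r.
  by rewrite mulr0 addr0 mulr0n subr0.
by rewrite mulmxDl -scalemxAl -rowE.
Qed.

Lemma row_selW i F : row (e i) (selW e F) = delta_mx 0 i :> 'rV[C]_m.
Proof.
apply/rowP => j; rewrite !mxE codom_f (inj_eq e_inj) eqxx /= eq_sym.
by case: eqP.
Qed.

Lemma row_selW_notin k (F : 'M[C]_(N, m)) : k \notin codom e -> row k (selW e F) = row k F.
Proof. by move=> /negPf ke; apply/rowP => j; rewrite !mxE ke. Qed.

Lemma row_genG i (d : 'I_N -> C) F :
  row i (genG e d F) = d (e i) *: delta_mx 0 i + row (e i) F.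
Proof. by apply/rowP => j; rewrite !mxE eqxx /= eq_sym; case: eqP; rewrite ?mulr1 ?mulr0. Qed.

Lemma fixed_wh_eq (t : 'I_N -> R) (d r : 'I_N -> C) (F : 'M[C]_(N, m)) :
  (forall k, if k \in codom e then
     [/\ t k = s k, r k + (s k)%:C%C * d k = (v k)%:C%C & d k * r k = (q k k)%:C%C - h 0 k]
   else t k = 1 /\ r k = h 0 k - (q k k)%:C%C) ->
  step_fixed e (toC c) (toCf t) d r F -> wh_eq (selW e F) (genG e d F).
Proof.
move=> rel fix_F k; rewrite row_Qh_mul -fix_F /pencil mulmxBr mul_mx_scalar -scalemxAr.
set G := genG e d F.
have [/codomP[i ki]|ke] := boolP (k \in codom e); last first.
  have [-> ->] := down_rows ke; have := rel k; rewrite (negPf ke) => -[-> ->].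
  rewrite row_selW_notin // rmorph0 rmorphN rmorph1; move: (row k F *m G) => x.
  by rewrite scale0r; apply/rowP => j; rewrite !mxE; ring.
(* On a selected row [W_k] is a basis vector and [F_k = G_k - d e_k]. With [v = r + s d] and
   [q - h = d r], expanding [(G_k - d e_k) (r - s G)] cancels every other term. *)
have := rel k; rewrite ki codom_f => -[-> <- <-].
rewrite row_selW -!rowE.
have -> : row (e i) F = row i G - d (e i) *: delta_mx 0 i.
  by rewrite row_genG addrC addKr.
rewrite mulmxBl -scalemxAl -rowE; move: (row i G) => g; move: (g *m G) => x.
by apply/rowP => j; rewrite !mxE; ring.
Qed.

(** For [Re a > 0] the resolvent comparison with [tk = 1] and [aR = Re a] makes [a - G] invertible,
    so [a] is no eigenvalue. *)
Lemma Dmat_genG (dR : 'I_N -> R) (d : 'I_N -> C) F FR :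
  (forall k, complex.Re (d k) <= dR k) -> dominated F FR -> rowsum_ok e dR FR ->
  Dmat (genG e d F).
Proof.
move=> ddR dF sF a /eigenvalueP[x xG x0].
rewrite -complexRe -[0](rmorph0 (real_complex R)) lecRR leNgt; apply/negP => a0.
have U := resolvent_unit ddR dF sF (ler01 : 0 <= 1 :> R) a0 (lexx _).
case/negP: x0; apply/eqP; rewrite -(mulmxK U x) mulmxBr mul_mx_scalar -scalemxAr xG.
by rewrite rmorph1 scale1r subrr mul0mx.
Qed.

Lemma step_fixed_toC (t dR rR : 'I_N -> R) (F : 'M[R]_(N, m)) :
  step_fixed e c t dR rR F ->
  step_fixed e (toC c) (toCf t) (toCf dR) (toCf rR) (toC F).
Proof.
have WE : toC (selW e F) = selW e (toC F).
  by apply/matrixP => i j; rewrite !mxE; case: ifP; rewrite ?rmorph_nat.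
have GE : toC (genG e dR F) = genG e (toCf dR) (toC F).
  by apply/matrixP => i j; rewrite !mxE rmorphD rmorphMn.
move=> fix_F k; have := congr1 (map_mx (real_complex R)) (fix_F k).
rewrite !map_mxM !map_row WE /pencil map_mxB map_scalar_mx map_mxZ GE.
exact.
Qed.

Let row_params k (t dR rR : R) (d r : C) : Prop :=
  [/\ 0 <= t, 0 < rR, complex.Re d <= dR & rR <= complex.Re r] /\
  if k \in codom e then
    [/\ t = s k, rR + s k * dR = v k, dR * rR = q k k - complex.Re (h 0 k),
        r + (s k)%:C%C * d = (v k)%:C%C & d * r = (q k k)%:C%C - h 0 k]
  else [/\ t = 1, rR = complex.Re (h 0 k) - q k k & r = h 0 k - (q k k)%:C%C].

Theorem wh_exists : exists (W : 'M[C]_(N, m)) (G : 'M[C]_m),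
  [/\ forall i j, W (e i) j = (i == j)%:R, wh_eq W G, Dmat G &
      (forall k, h 0 k = 'Re (h 0 k)) -> subgenerator G /\ subprob W].
Proof.
have /fin_all_exists[f fP] (k : 'I_N) : exists f : R * R * R * C * C,
    row_params k f.1.1.1.1 f.1.1.1.2 f.1.1.2 f.1.2 f.2.
  rewrite /row_params; have [/codomP[i ->]|ke] := boolP (k \in codom e).
    have zE : complex.Re (h 0 (e i) - (q (e i) (e i))%:C%C)
        = complex.Re (h 0 (e i)) - q (e i) (e i) by rewrite ReB.
    have := a_gt0 (e i); rewrite -zE => z0.
    have [dR [rR [d [r [[p1 p2 p3] [e1 e2 e3 e4]]]]]] :=
      quadratic_split (s_ge0 (e i)) (@up_rows i) z0.
    exists (s (e i), dR, rR, d, r); split; first by split=> //; apply: s_ge0.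
    split=> //.
      by rewrite /= e2 zE opprB.
    by rewrite /= e4 opprB.
  (* The zeros are defaults: off the selected rows neither [bnd] nor [genG] reads [dR] and [d]. *)
  exists (1, 0, complex.Re (h 0 k) - q k k, 0, h 0 k - (q k k)%:C%C).
  by split; split=> //=; rewrite ?ReB ?a_gt0.
pose t k := (f k).1.1.1.1; pose dR k := (f k).1.1.1.2; pose rR k := (f k).1.1.2.
pose d k := (f k).1.2; pose r k := (f k).2.
have {}fP k : row_params k (t k) (dR k) (rR k) (d k) (r k) by apply: fP.
have t0 k : 0 <= t k by case: (fP k) => [[]].
have rR0 k : 0 < rR k by case: (fP k) => [[]].
have ddR k : complex.Re (d k) <= dR k by case: (fP k) => [[]].
have rrR k : rR k <= complex.Re (r k) by case: (fP k) => [[]].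
have c0 i j : 0 <= c i j by rewrite mxE; case: eqVneq => // /q_off.
(* On every row [bnd e dR k * rR k] equals [Re (h k) - q k k], by the product of the roots on
   selected rows and by the choice of [rR] elsewhere. *)
have csum k : \sum_j c k j <= bnd e dR k * rR k.
  have le1 : \sum_j c k j <= complex.Re (h 0 k) - q k k.
    have := q_sum k; rewrite (bigD1 k) //= => qk.
    rewrite (bigD1 k) //= mxE eqxx add0r.
    rewrite (eq_bigr (fun j => q k j)); first by have := h_ge0 k; move: qk; lra.
    by move=> j /negPf jk; rewrite mxE eq_sym jk.
  have [_] := fP k; rewrite /row_params /bnd; case: ifP => _; last by case=> _ ->; rewrite mul1r.
  by case=> _ _ e2 _ _; rewrite mulNr e2 opprB.
have [L [LR [dL sL fixL fixLR]]] :=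
  step_fixed_exists e_inj c0 t0 rR0 ddR rrR csum.
(* The witness depends on [h]: for real [h] it is the limit [LR] of the real iteration, whose signs
   and row sums are known, and otherwise the complex limit [L]. *)
have [hreal|hnreal] := boolP [forall k, h 0 k == 'Re (h 0 k)]; last first.
  exists (selW e L), (genG e d L); split.
  - move=> i j; rewrite mxE codom_f (inj_eq e_inj) //.
  - apply: fixed_wh_eq fixL => k; have [_] := fP k.
    by case: ifP => _ [].
  - exact: Dmat_genG dL sL.
  - by move=> hr; case/forallP: hnreal => k; apply/eqP.
have LR0 i j : 0 <= LR i j by apply: dominated_ge0 dL.
have dLR : dominated (toC LR) LR by apply: dominated_toC.
exists (selW e (toC LR)), (genG e (toCf dR) (toC LR)); split.
- move=> i j; rewrite mxE codom_f (inj_eq e_inj) //.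
- apply: (fixed_wh_eq (t := t) (r := toCf rR)) (step_fixed_toC fixLR) => k; have [_] := fP k.
  have hk : h 0 k = (complex.Re (h 0 k))%:C%C.
    by rewrite complexRe; apply/eqP; apply: (forallP hreal).
  case: ifP => _ []; last by move=> -> -> _; rewrite hk rmorphB.
  move=> -> e1 e2 _ _; split=> //; first by rewrite -e1 rmorphD rmorphM.
  by rewrite hk -rmorphM /= e2 rmorphB.
- by apply: Dmat_genG dLR sL => k /=.
move=> _; split; split.
- move=> i j ij; rewrite !mxE (negPf ij) add0r.
  by rewrite -[0](rmorph0 (real_complex R)) lecRR.
- move=> i; have := genG_sum_le0 sL i; rewrite -lecRR rmorph0 rmorph_sum.
  congr (_ <= 0); apply: eq_bigr => j _; by rewrite !mxE rmorphD rmorphMn.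
- move=> i j; rewrite !mxE; case: ifP => _; first exact: ler0n.
  by rewrite -[0](rmorph0 (real_complex R)) lecRR.
- move=> k; have := selW_sum_le1 e_inj sL k; rewrite -lecRR rmorph1 rmorph_sum.
  congr (_ <= 1); apply: eq_bigr => j _; rewrite !mxE; case: ifP => _ //.
  by rewrite rmorph_nat.
Qed.

End Existence.

(** * Products of linear factors evaluated at a matrix *)

Section RootProducts.
Variable F : closedFieldType.

(** The monic polynomial with roots [rs] evaluated at [A], as a plain product that makes sense in
    size 0 too. *)
Definition root_prod n (A : 'M[F]_n) (rs : seq F) : 'M[F]_n :=
  foldr (fun a M => (A - a%:M) *m M) 1%:M rs.

Lemma root_prod_cat n (A : 'M[F]_n) rs rs' :
  root_prod A (rs ++ rs') = root_prod A rs *m root_prod A rs'.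
Proof. by elim: rs => [|a rs IHrs] /=; rewrite ?mul1mx // IHrs mulmxA. Qed.

Lemma root_prod_intertwine n m (A : 'M[F]_n) (B : 'M[F]_m) X rs :
  A *m X = X *m B -> root_prod A rs *m X = X *m root_prod B rs.
Proof.
move=> AX; elim: rs => [|a rs IHrs] /=; first by rewrite mul1mx mulmx1.
rewrite -mulmxA IHrs !mulmxA; congr (_ *m _).
by rewrite mulmxBl mulmxBr AX mul_scalar_mx mul_mx_scalar.
Qed.

(** Cayley-Hamilton, with the characteristic polynomial split over the closed field. *)
Lemma root_prod_annihilates n (A : 'M[F]_n) :
  exists rs, root_prod A rs = 0 /\ {in rs, forall a, eigenvalue A a}.
Proof.
case: n A => [|n] A.
  by exists [::]; split=> //; apply: flatmx0.
have [rs] := closed_field_poly_normal (char_poly A).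
rewrite (monicP (char_poly_monic A)) scale1r => Ars.
exists rs; split; last first.
  by move=> a ars; rewrite eigenvalue_root_char Ars root_prod_XsubC.
rewrite -[RHS](Cayley_Hamilton A) Ars rmorph_prod /=.
elim: rs {Ars} => [|a rs IHrs] /=; first by rewrite big_nil.
by rewrite big_cons IHrs rmorphB /= horner_mx_X horner_mx_C.
Qed.

Lemma root_prod_unit n (A : 'M[F]_n) rs :
  {in rs, forall a, ~~ eigenvalue A a} -> root_prod A rs \in unitmx.
Proof.
elim: rs => [|a rs IHrs] /= ev; first exact: unitmx1.
rewrite unitmx_mul IHrs ?andbT; last by move=> b brs; apply: ev; rewrite inE brs orbT.
rewrite -row_free_unit -kermx_eq0; apply/negPn.
by have := ev a (mem_head _ _).
Qed.

(** [eigenvalue] speaks of row eigenvectors, whereas the equation for [W] and [G] is applied to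
    column eigenvectors of [G]. *)
Lemma eigenvalue_tr n (A : 'M[F]_n) a : eigenvalue A^T a = eigenvalue A a.
Proof.
have E (B : 'M[F]_n) : eigenvalue B a = (B - a%:M \notin unitmx).
  by rewrite /eigenvalue /eigenspace kermx_eq0 row_free_unit.
by rewrite !E -unitmx_tr linearB /= trmxK tr_scalar_mx.
Qed.

End RootProducts.

(** * Spectral separation and uniqueness *)

Section Spectrum.
Variables (R : realType) (N n0 : nat) (z : 'I_n0 -> 'I_N).
Local Notation C := R[i].
Variables (q : 'M[R]_N) (s v w : 'I_N -> R) (h : 'rV[C]_N).

Hypothesis z_inj : injective z.
Hypothesis q_off : forall i j, i != j -> 0 <= q i j.
Hypothesis s_ge0 : forall k, 0 <= s k.
Hypothesis sz_neq0 : forall i, s (z i) != 0.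
Hypothesis nz_rows : forall k, k \notin codom z -> s k = 0 /\ v k * v k = 1.
Hypothesis w_gt0 : forall k, 0 < w k.
Hypothesis qw_lt : forall k, \sum_j q k j * w j < complex.Re (h 0 k) * w k.

Section Solution.
Variables (m : nat) (e : 'I_m -> 'I_N) (W : 'M[C]_(N, m)) (G : 'M[C]_m).
Hypothesis We : rowsub e W = 1%:M.
Hypothesis WG : wh_eq q s v h W G.

(** A column eigenvector [x] of [G] gives [f = W x], non-zero because [W] contains an identity, with
    [(s a^2 - v a + Q_h) f = 0]. For imaginary [a], [s a^2] is real and non-positive and [v a] is
    imaginary, so the diagonal has real part at most [q k k - Re (h k)] and the weight [w] makes the
    matrix invertible. *)
Lemma wh_eigenvalue_neq0 a : eigenvalue G a -> complex.Re a != 0.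
Proof.
rewrite -eigenvalue_tr => /eigenvalueP[x xG x0]; apply/negP => /eqP a0.
have Gy : G *m x^T = a *: x^T by apply: trmx_inj; rewrite trmx_mul trmxK xG linearZ /= trmxK.
pose f := W *m x^T.
have f0 : f != 0.
  apply: contraNneq x0 => f0; rewrite -(trmxK x) -[x^T]mul1mx -We.
  by rewrite mul_rowsub_mx -/f f0; apply/eqP/matrixP => i j; rewrite !mxE.
pose A : 'M[C]_N := Qh q h + diag_mx (\row_k ((s k)%:C%C * (a * a) - (v k)%:C%C * a)).
pose B : 'M[R]_N := \matrix_(i, j) (complex.Re (h 0 i) *+ (i == j) - q i j).
have Af : A *m f = 0.
  apply/row_matrixP => k; rewrite row0 row_mul.
  have fk : row k f = row k W *m x^T by rewrite row_mul.
  have := congr1 (mulmx^~ x^T) (WG k).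
  rewrite mul0mx mulmxDl mulmxBl -!scalemxAl -!mulmxA Gy -!scalemxAr Gy -!scalemxAr.
  rewrite -/f -fk !scalerA => H.
  have -> : row k A = row k (Qh q h) +
      ((s k)%:C%C * (a * a) - (v k)%:C%C * a) *: delta_mx 0 k.
    apply/rowP => j; rewrite !mxE /= [k == j]eq_sym.
    by case: (j == k); rewrite ?mulr1n ?mulr0n ?mulr1 ?mulr0.
  rewrite mulmxDl -scalemxAl -rowE addrC scalerBl; exact: H.
have UA : A \in unitmx.
  apply: (@Mmatrix_unit _ _ A B w) => //.
  - move=> i; rewrite (eq_bigr (fun j => complex.Re (h 0 i) *+ (i == j) * w j - q i j * w j)).
      rewrite sumrB (bigD1 i) //= eqxx mulr1n big1 ?addr0 ?subr_gt0 //.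
      by move=> j; rewrite eq_sym => /negPf ->; rewrite mulr0n mul0r.
    by move=> j _; rewrite mxE mulrBl.
  - move=> i; apply: le_trans (normRe_le_absc _); rewrite -normrN; apply: le_trans (ler_norm _).
    rewrite !mxE eqxx !mulr1n ReD !ReB !Re_mul_real a0 mulr0 subr0.
    have -> : complex.Re (a * a) = - (complex.Im a * complex.Im a).
      by case: (a) a0 => xa ya /= ->; rewrite mul0r sub0r.
    have : 0 <= s i * (complex.Im a * complex.Im a).
      by rewrite mulr_ge0 // -expr2 sqr_ge0.
    rewrite /=; lra.
  - move=> i j /negPf ij; rewrite !mxE ij !mulr0n addr0 subr0 sub0r opprK absc_real.
    by rewrite ger0_norm // q_off // ij.
by case/eqP: f0; rewrite -(mulKmx UA f) Af mulmx0.
Qed.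

(** Multiplication by [G] on the pair formed by [W] and the [E^0] rows of [W G]. Rows with [s = 0]
    are solved for [W_k G] using [v_k^2 = 1]; rows of [E^0] are divided by [s]. *)
Definition companion : 'M[C]_(N + n0) :=
  block_mx (\matrix_k if k \in codom z then 0 else (v k)%:C%C *: row k (Qh q h))
           (\matrix_(k, i) (k == z i)%:R)
           (\matrix_i (- (s (z i))%:C%C^-1 *: row (z i) (Qh q h)))
           (diag_mx (\row_i ((v (z i))%:C%C / (s (z i))%:C%C))).

Definition extended : 'M[C]_(N + n0, m) := col_mx W (rowsub z (W *m G)).

Lemma companion_extended : companion *m extended = extended *m G.
Proof.
rewrite /companion /extended mul_block_col mul_col_mx; congr col_mx; apply/row_matrixP.
  move=> k; rewrite linearD /= !row_mul rowK.
  have [/codomP[i ->]|kz] := boolP (k \in codom z).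
    rewrite mul0mx add0r (_ : row _ _ = delta_mx 0 i).
      by rewrite -rowE row_rowsub row_mul.
    by apply/rowP => j; rewrite !mxE eqxx /= (inj_eq z_inj) eq_sym; case: eqP.
  have [sk vk] := nz_rows kz; rewrite (_ : row k (\matrix_(k, i) _) = 0); last first.
    apply/rowP => j; rewrite !mxE; case: eqP => // kj.
    by rewrite kj codom_f in kz.
  rewrite mul0mx addr0 -scalemxAl; have := WG k; rewrite sk rmorph0 scale0r sub0r addrC.
  move/eqP; rewrite subr_eq0 => /eqP ->.
  by rewrite scalerA -rmorphM vk rmorph1 scale1r.
move=> i; rewrite linearD /= !row_mul rowK row_diag_mx -!scalemxAl -rowE mxE.
rewrite row_rowsub row_mul; have sn : (s (z i))%:C%C != 0 :> C.
  by rewrite -(rmorph0 (real_complex R)) (inj_eq (@complexI R)).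
apply: (scalerI sn); rewrite scalerDr !scalerA mulrN mulfV // mulrCA mulfV // mulr1.
rewrite scaleN1r; have /eqP := WG (z i).
by rewrite addr_eq0 subr_eq => /eqP ->.
Qed.

Lemma extended_rank : \rank extended = m.
Proof.
apply/eqP; rewrite eqn_leq rank_leq_col /=.
have := mxrankM_maxr (row_mx (rowsub e 1%:M) 0) extended.
rewrite /extended mul_row_col mul0mx addr0 mul_rowsub_mx mul1mx We mxrank1.
exact.
Qed.

End Solution.

(** [P] annihilates the column spaces of [X] and [X'] and is injective on that of the [H]-solution,
    so its kernel has dimension at most [m1] and is the column space of [X]. Hence [X' = X D], and
    the identity rows force [D = 1]. *)
Theorem wh_unique m1 m2 (e1 : 'I_m1 -> 'I_N) (e2 : 'I_m2 -> 'I_N) W G W' G' Y H :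
  (m1 + m2 = N + n0)%N ->
  rowsub e1 W = 1%:M -> wh_eq q s v h W G ->
  rowsub e1 W' = 1%:M -> wh_eq q s v h W' G' ->
  rowsub e2 Y = 1%:M -> wh_eq q s v h Y H ->
  (forall a, eigenvalue H a -> ~~ eigenvalue G a /\ ~~ eigenvalue G' a) ->
  W' = W /\ G' = G.
Proof.
move=> dim We WG We' WG' Ye YH disj.
have [rs [Grs rsG]] := root_prod_annihilates G.
have [rs' [Grs' rsG']] := root_prod_annihilates G'.
have CX := companion_extended WG; have CX' := companion_extended WG'.
have CY := companion_extended YH.
set X := extended W G in CX; set X' := extended W' G' in CX'.
set P := root_prod companion (rs ++ rs').
have PX : P *m X = 0.
  by rewrite /P (root_prod_intertwine _ CX) root_prod_cat Grs mul0mx mulmx0.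
have PX' : P *m X' = 0.
  by rewrite /P (root_prod_intertwine _ CX') root_prod_cat Grs' !mulmx0.
have rP : (m2 <= \rank P)%N.
  rewrite -(extended_rank H Ye).
  have U : root_prod H (rs ++ rs') \in unitmx.
    apply: root_prod_unit => a; rewrite mem_cat => /orP[/rsG|/rsG'] ev.
      by apply/negP => /disj[]; rewrite ev.
    by apply/negP => /disj[_]; rewrite ev.
  have <- : \rank (P *m extended Y H) = \rank (extended Y H).
    rewrite /P (root_prod_intertwine _ CY).
    by rewrite mxrankMfree // row_free_unit.
  exact: mxrankM_maxl.
have XK : (X^T <= kermx P^T)%MS by apply/sub_kermxP; rewrite -trmx_mul PX trmx0.
have XK' : (X'^T <= kermx P^T)%MS by apply/sub_kermxP; rewrite -trmx_mul PX' trmx0.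
have KX : (kermx P^T <= X^T)%MS.
  rewrite -(geq_leqif (mxrank_leqif_sup XK)) mxrank_ker !mxrank_tr.
  rewrite (extended_rank G We) leq_subLR; move: (\rank P) rP => r rP.
  by rewrite -dim addnC leq_add2r.
have /submxP[D XD] := submx_trans XK' KX.
have {XD} XD : X' = X *m D^T by apply: trmx_inj; rewrite trmx_mul trmxK.
have [WD _] : W' = W *m D^T /\ rowsub z (W' *m G') = rowsub z (W *m G) *m D^T.
  by apply/eq_col_mx; rewrite -mul_col_mx.
have D1 : D^T = 1%:M.
  by rewrite -[RHS]We' WD -mul_rowsub_mx We mul1mx.
rewrite D1 mulmx1 in WD; rewrite D1 mulmx1 in XD; split=> //.
have : X *m G' = X *m G by rewrite -CX -XD CX' XD.
rewrite /X /extended !mul_col_mx => /eq_col_mx[WGG _].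
by rewrite -[G']mul1mx -[G]mul1mx -We !mul_rowsub_mx WGG.
Qed.

End Spectrum.

(** * A positive weight for a sub-generator *)

Lemma common_small_scale (R : realFieldType) (I : finType) (a b : I -> R) :
  (forall i, 0 < b i) -> exists2 delta, 0 < delta & forall i, delta * a i < b i.
Proof.
(* [1 + S] exceeds each ratio [|a i| / b i], and is positive even when [I] is empty. *)
move=> b0; pose S := \sum_i `|a i| / b i.
have ab0 i : 0 <= `|a i| / b i by rewrite divr_ge0 // ltW.
have S1 : 0 < 1 + S by rewrite ltr_wpDr // sumr_ge0.
exists (1 + S)^-1; first by rewrite invr_gt0.
move=> i; rewrite mulrC ltr_pdivrMr // mulrC; apply: le_lt_trans (ler_norm _) _.
rewrite -ltr_pdivrMr //; apply: le_lt_trans (_ : S < _); last by rewrite ltrDr.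
by rewrite /S (bigD1 i) //= lerDl sumr_ge0.
Qed.

(** The weight is a small perturbation [1 + delta u] of the constant vector: rows with [h k > 0]
    leave slack, and on the others [(q u) k < 0] gives strictness. *)
Lemma subgenerator_weight (R : realType) N (q : 'M[R]_N) (h : 'I_N -> R) (u : 'cV[R]_N) :
  (forall k, \sum_j q k j <= 0) -> (forall k, 0 <= h k) ->
  (forall k, 0 < h k \/ (q *m u) k 0 < 0) ->
  exists w : 'I_N -> R, (forall k, 0 < w k) /\
    forall k, \sum_j q k j * w j < h k * w k.
Proof.
move=> q1 h0 hu.
(* The index [(k, true)] encodes positivity of [1 + delta u k], and [(k, false)] the strict
   inequality on row [k] when [h k > 0]. *)
pose a (x : 'I_N * bool) : R := if x.2 then - u x.1 0 else
  if 0 < h x.1 then (q *m u) x.1 0 - h x.1 * u x.1 0 else 0.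
pose b (x : 'I_N * bool) : R := if x.2 then 1 else if 0 < h x.1 then h x.1 else 1.
have b0 x : 0 < b x by rewrite /b; case: x.2 => //; case: ifP.
have [delta d0 dab] := common_small_scale a b0.
exists (fun k => 1 + delta * u k 0).
have w0 k : 0 < 1 + delta * u k 0 by have := dab (k, true); rewrite /a /b /=; lra.
split=> // k.
have -> : \sum_j q k j * (1 + delta * u j 0) = \sum_j q k j + delta * (q *m u) k 0.
  rewrite mxE mulr_sumr -big_split; apply: eq_bigr => j _ /=; ring.
have := dab (k, false); rewrite /a /b /=; have := q1 k.
case: ifP => [hk|/negbT hk] q1k dk; first by nra.
have [|qu] := hu k; first by rewrite (negPf hk).
have := w0 k; have := h0 k; nra.
Qed.

(** * Block matrices of the phase-type parameters *)

Section PhaseBlocks.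
Variables (R : realType) (n0 : nat) (mp : 'I_n0 -> nat).
Variables (B : forall i, 'M[R]_(mp i)).
Hypothesis subB : forall i, subgenerator (B i).

Lemma mxdiag_off_ge0 k l : k != l -> 0 <= (\mxdiag_i B i) k l.
Proof.
rewrite -{1}(tagnat.sig2K k) -{1}(tagnat.sig2K l) mxE.
move: (tagnat.sig2 k) (tagnat.sig2 l); move: (tagnat.sig1 k) (tagnat.sig1 l) => i j x y.
have [ij|ij _] := eqVneq i j; last by rewrite mxE.
move: y; case: _ / ij => y; rewrite conform_mx_id => xy.
by apply: (subB i).1; apply: contraNneq xy => ->.
Qed.

Lemma exit_ge0 k j :
  0 <= (\mxcol_(i < n0) ((- (B i *m const_mx 1)) *m delta_mx (0 : 'I_1) i)
        : 'M[R]_(\sum_i mp i, n0)) k j.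
Proof.
rewrite mxE; move: (tagnat.sig2 k); move: (tagnat.sig1 k) => i x.
rewrite mxE big_ord1 mulr_ge0 //; last by rewrite mxE ler0n.
rewrite !mxE oppr_ge0; apply: le_trans ((subB i).2 x).
by apply: ler_sum => l _; rewrite mxE mulr1.
Qed.

Lemma mxdiag_exit_sum :
  \mxdiag_i B i *m const_mx 1 +
  (\mxcol_(i < n0) ((- (B i *m const_mx 1)) *m delta_mx (0 : 'I_1) i)) *m const_mx 1
  = 0 :> 'cV[R]_(\sum_i mp i).
Proof.
rewrite -[X in _ *m X + _]mxcol_const mul_mxdiag_mxcol mxcol_mul -mxcolD.
rewrite -[RHS]mxcol0; apply: eq_mxcol => i; rewrite -mulmxA.
have -> : delta_mx (0 : 'I_1) i *m const_mx 1 = 1%:M :> 'M[R]_1.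
  by rewrite -rowE; apply/rowP => l; rewrite !mxE (ord1 l).
by rewrite mulmx1 subrr.
Qed.

(** [u] lists the mean absorption times of the phases; it serves as the perturbation in
    [subgenerator_weight] where [h] may vanish. *)
Lemma mxdiag_solve : (forall i, B i \in unitmx) ->
  exists u : 'cV[R]_(\sum_i mp i), \mxdiag_i B i *m u = const_mx (-1).
Proof.
move=> UB; exists (\mxcol_i (invmx (B i) *m const_mx (-1))).
rewrite mul_mxdiag_mxcol -[RHS]mxcol_const; apply: eq_mxcol => i.
by rewrite mulKVmx.
Qed.

Variables (beta : forall i, 'rV[R]_(mp i)) (c : 'I_n0 -> R).
Hypothesis beta_prob : forall i, probvec (beta i).

Lemma entrance_ge0 k j : (forall i, 0 <= c i) ->
  0 <= (\mxrow_(i < n0) (delta_mx i (0 : 'I_1) *m (c i *: beta i))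
        : 'M[R]_(n0, \sum_i mp i)) k j.
Proof.
move=> c0; rewrite mxE; move: (tagnat.sig2 j); move: (tagnat.sig1 j) => i x.
rewrite mxE big_ord1 mulr_ge0 //; first by rewrite mxE ler0n.
by rewrite mxE mulr_ge0 // (beta_prob i).1.
Qed.

Lemma entrance_sum :
  (\mxrow_(i < n0) (delta_mx i (0 : 'I_1) *m (c i *: beta i))) *m const_mx 1
  = \col_i c i :> 'cV[R]_n0.
Proof.
rewrite -[X in _ *m X]mxcol_const mul_mxrow_mxcol; apply/colP => k.
rewrite summxE mxE (bigD1 k) //= big1 ?addr0; last first.
  by move=> i /negPf ik; rewrite -mulmxA mxE big_ord1 mxE eq_sym ik mul0r.
transitivity (c k * \sum_j beta k 0 j); last by rewrite (beta_prob k).2 mulr1.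
rewrite -mulmxA mxE big_ord1 !mxE !eqxx mul1r mulr_sumr.
by apply: eq_bigr => j _; rewrite !mxE mulr1.
Qed.

End PhaseBlocks.

(** * Generator property of [Q_0] and its weight *)

Section Generator.
Variables (R : realType) (n0 : nat) (mp mm : 'I_n0 -> nat).
Variables (Q : 'M[R]_n0) (lam p : 'I_n0 -> R).
Variables (betap : forall i, 'rV[R]_(mp i)) (Bp : forall i, 'M[R]_(mp i)).
Variables (betam : forall i, 'rV[R]_(mm i)) (Bm : forall i, 'M[R]_(mm i)).
Hypothesis Qgen : generator Q.
Hypothesis lam_ge0 : forall i, 0 <= lam i.
Hypothesis p01 : forall i, 0 <= p i <= 1.
Hypothesis PHp : forall i, PHparams (betap i) (Bp i).
Hypothesis PHm : forall i, PHparams (betam i) (Bm i).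
Local Notation q := (Q0 Q lam p betap Bp betam Bm).
Local Notation np := (Np mp).
Local Notation nm := (Nm mm).

Lemma Q0_off i j : i != j -> 0 <= q i j.
Proof.
have sBp k : subgenerator (Bp k) by case: (PHp k) => _ [].
have sBm k : subgenerator (Bm k) by case: (PHm k) => _ [].
have bp k : probvec (betap k) by case: (PHp k).
have bm k : probvec (betam k) by case: (PHm k).
have lp k : 0 <= lamp lam p k by rewrite mulr_ge0 //; case/andP: (p01 k).
have lm k : 0 <= lamm lam p k by rewrite mulr_ge0 // subr_ge0; case/andP: (p01 k).
rewrite /Q0; case: (split_ordP i) => {i} i ->; case: (split_ordP j) => {j} j ->.
- rewrite block_mxEul (inj_eq (@lshift_inj _ _)).
  case: (split_ordP i) => {i} i ->; case: (split_ordP j) => {j} j -> ij.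
  + rewrite block_mxEul; apply: mxdiag_off_ge0 => //.
  + by rewrite block_mxEur; apply: exit_ge0.
  + by rewrite block_mxEdl; apply: entrance_ge0.
  + have {}ij : i != j by apply: contraNneq ij => ->.
    by rewrite block_mxEdr !mxE (negPf ij) mulr0n subr0 Qgen.1.
- move=> _; rewrite block_mxEur.
  case: (split_ordP i) => {i} i ->; first by rewrite col_mxEu mxE.
  by rewrite col_mxEd; apply: entrance_ge0.
- move=> _; rewrite block_mxEdl.
  case: (split_ordP j) => {j} j ->; first by rewrite row_mxEl mxE.
  by rewrite row_mxEr; apply: exit_ge0.
- rewrite block_mxEdr (inj_eq (@rshift_inj _ _)); exact: mxdiag_off_ge0.
Qed.

(** Exit rates cancel the row sums of the phase blocks, and the entrance rates [lamp + lamm = lam]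
    compensate the term [- lam]. *)
Lemma Q0_mul1 : q *m const_mx 1 = 0 :> 'cV[R]_(np + n0 + nm).
Proof.
have bp k : probvec (betap k) by case: (PHp k).
have bm k : probvec (betam k) by case: (PHm k).
rewrite -!col_mx_const /Q0 !mul_block_col mul_col_mx mul_row_col !mul0mx.
rewrite add_col_mx addr0 add0r /BPlus /bPlus mxdiag_exit_sum.
rewrite [_ *m _ + BMinus Bm *m _]addrC /BMinus /bMinus mxdiag_exit_sum.
rewrite /APlus /AMinus !entrance_sum //.
set x := (X in col_mx (col_mx _ X) _); suff -> : x = 0 by rewrite !col_mx0.
apply/colP => i; rewrite /x mulmxBl !mxE.
rewrite (eq_bigr (fun j => Q i j)) ?Qgen.2; last by move=> j _; rewrite mxE mulr1.
rewrite (bigD1 i) //= big1 ?addr0; last first.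
  by move=> j /negPf ij; rewrite !mxE eq_sym ij mulr0n mul0r.
by rewrite !mxE eqxx mulr1n /lamp /lamm; ring.
Qed.

Lemma Q0_sum i : \sum_j q i j = 0.
Proof.
have /colP/(_ i) := Q0_mul1; rewrite mxE [RHS]mxE => q1; rewrite -[RHS]q1.
by apply: eq_bigr => j _; rewrite [X in _ = _ * X]mxE mulr1.
Qed.

Lemma Q0_weight (h : 'I_(np + n0 + nm) -> R) :
  (forall k, 0 <= h k) -> (forall i, 0 < h (lshift nm (rshift np i))) ->
  exists w : 'I_(np + n0 + nm) -> R, (forall k, 0 < w k) /\
    forall k, \sum_j q k j * w j < h k * w k.
Proof.
move=> h0 hE.
have [|up Bup] := @mxdiag_solve R n0 mp Bp; first by move=> i; case: (PHp i) => _ [].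
have [|um Bum] := @mxdiag_solve R n0 mm Bm; first by move=> i; case: (PHm i) => _ [].
(* With [u = 0] on [E^0] the phase rows of [Q_0 u] reduce to [B u = -1]; on [E^0] itself [h > 0]. *)
apply: (@subgenerator_weight R _ q h (col_mx (col_mx up (0 : 'cV_n0)) um)) => //.
  by move=> k; rewrite Q0_sum.
have m1 : -1 < 0 :> R by rewrite oppr_lt0.
move=> k; case: (split_ordP k) => {k} k ->; last first.
  right; rewrite /Q0 mul_block_col col_mxEd mul_row_col !(mul0mx, mulmx0) !add0r.
  by rewrite /BMinus Bum mxE.
case: (split_ordP k) => {k} k ->; [right | by left].
rewrite /Q0 mul_block_col col_mxEu mul_block_col !mulmx0 mul_col_mx add_col_mx col_mxEu.
by rewrite mul0mx !addr0 /BPlus Bup mxE.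
Qed.

End Generator.

(** * From row equations to the pair of factors *)

Lemma wh_eqP (R : realType) N m (q : 'M[R]_N) (h : 'rV[R[i]]_N) (sg vv : 'rV[R]_N)
    (v : 'I_N -> R) (W : 'M[R[i]]_(N, m)) (G : 'M[R[i]]_m) :
  (forall k, vv 0 k = v k) ->
  2%:R^-1 *: (toC (diag_mx sg) *m toC (diag_mx sg) *m W *m (G *m G))
    - toC (diag_mx vv) *m W *m G + Qh q h *m W = 0
  <-> wh_eq q (fun k => 2%:R^-1 * (sg 0 k * sg 0 k)) v h W G.
Proof.
move=> vE; set E := (X in X = 0 <-> _).
have rowE k : row k E =
  ((2%:R^-1 * (sg 0 k * sg 0 k) : R)%:C%C) *: (row k W *m G *m G)
    - ((v k)%:C%C) *: (row k W *m G) + row k (Qh q h) *m W.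
  have rd (d : 'rV[R]_N) p (M : 'M[R[i]]_(N, p)) :
      row k (toC (diag_mx d) *m M) = (d 0 k)%:C%C *: row k M.
    rewrite row_mul map_diag_mx row_diag_mx -scalemxAl -rowE mxE //.
  rewrite /E linearD linearB linearZ /= -!mulmxA !rd row_mul !scalerA vE.
  by rewrite rmorphM rmorphM fmorphV rmorph_nat /= !row_mul.
split=> [E0 k|eqk]; first by rewrite -rowE E0 row0.
by apply/row_matrixP => k; rewrite rowE row0 eqk.
Qed.

(** Puts a solution of the minus equation over the same companion matrix as the plus solutions. *)
Lemma wh_eqN (R : realType) N m (q : 'M[R]_N) (h : 'rV[R[i]]_N) (s v : 'I_N -> R)
    (W : 'M[R[i]]_(N, m)) (G : 'M[R[i]]_m) :
  wh_eq q s (fun k => - v k) h W G -> wh_eq q s v h W (- G).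
Proof.
move=> WG k; rewrite -[RHS](WG k) !mulmxN mulNmx opprK rmorphN /= scaleNr.
by rewrite scalerN.
Qed.

Lemma eigenvalueN (F : fieldType) n (A : 'M[F]_n) a :
  eigenvalue (- A) a -> eigenvalue A (- a).
Proof.
move=> /eigenvalueP[x xA x0]; apply/eigenvalueP; exists x => //.
by rewrite scaleNr -xA mulmxN opprK.
Qed.

Section Assembly.
Variables (R : realType) (np n0 nm : nat).
Local Notation C := R[i].
Local Notation N := (np + n0 + nm)%N.

Definition selP (i : 'I_(np + n0)) : 'I_N := lshift nm i.
Definition selM (i : 'I_(n0 + nm)) : 'I_N := cast_ord (addnA np n0 nm) (rshift np i).
Definition selZ (i : 'I_n0) : 'I_N := lshift nm (rshift np i).

Lemma selP_inj : injective selP. Proof. exact: lshift_inj. Qed.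
Lemma selM_inj : injective selM.
Proof. by move=> i j /cast_ord_inj/rshift_inj. Qed.
Lemma selZ_inj : injective selZ.
Proof. by move=> i j /lshift_inj/rshift_inj. Qed.

Lemma selM_lshift i : selM (lshift nm i) = selZ i.
Proof. exact: val_inj. Qed.

Lemma selM_rshift i : selM (rshift n0 i) = rshift (np + n0) i.
Proof. by apply: val_inj; rewrite /= addnA. Qed.

Lemma rowsub_selP (W : 'M[C]_(N, np + n0)) :
  rowsub selP W = 1%:M <-> exists U, W = col_mx 1%:M U.
Proof.
split=> [We|[U ->]]; last first.
  by apply/matrixP => i j; rewrite mxE /selP col_mxEu.
exists (dsubmx W); rewrite -[LHS]vsubmxK; congr col_mx; rewrite -We.
by apply/matrixP => i j; rewrite !mxE.
Qed.

Lemma rowsub_selM (W : 'M[C]_(N, n0 + nm)) :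
  rowsub selM W = 1%:M <->
  exists U, W = castmx (addnA np n0 nm, erefl (n0 + nm)%N) (col_mx U 1%:M).
Proof.
split=> [We|[U ->]]; last first.
  apply/matrixP => i j; rewrite mxE castmxE /= /selM cast_ordK col_mxEd.
  by rewrite cast_ord_id.
pose W' := castmx (esym (addnA np n0 nm), erefl (n0 + nm)%N) W.
exists (usubmx W'); have <- : dsubmx W' = 1%:M.
  rewrite -We; apply/matrixP => i j; rewrite !mxE castmxE /= cast_ord_id.
  by congr (W _ _); apply: val_inj.
by rewrite vsubmxK /W' castmxKV.
Qed.

Variables (sigma mu : 'I_n0 -> R).

Definition sgrow : 'rV[R]_N := row_mx (row_mx 0 (\row_i sigma i)) 0.
Definition vvrow : 'rV[R]_N := row_mx (row_mx (const_mx 1) (\row_i mu i)) (const_mx (-1)).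

Definition srow k : R := 2%:R^-1 * (sgrow 0 k * sgrow 0 k).

Lemma srow_ge0 k : 0 <= srow k.
Proof. by rewrite mulr_ge0 ?invr_ge0 // -expr2 sqr_ge0. Qed.

Lemma srow_Z i : (forall i, 0 < sigma i) -> 0 < srow (selZ i).
Proof.
move=> sp; rewrite mulr_gt0 ?invr_gt0 // /sgrow row_mxEl row_mxEr mxE.
by rewrite mulr_gt0.
Qed.

Lemma srow_up i : srow (lshift nm (lshift n0 i)) = 0.
Proof. by rewrite /srow /sgrow row_mxEl row_mxEl mxE !mulr0. Qed.

Lemma srow_down i : srow (rshift (np + n0) i) = 0.
Proof. by rewrite /srow /sgrow row_mxEr mxE !mulr0. Qed.

Lemma vvrow_up i : vvrow 0 (lshift nm (lshift n0 i)) = 1.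
Proof. by rewrite /vvrow row_mxEl row_mxEl mxE. Qed.

Lemma vvrow_down i : vvrow 0 (rshift (np + n0) i) = -1.
Proof. by rewrite /vvrow row_mxEr mxE. Qed.

Variables (q : 'M[R]_N) (h : 'rV[C]_N) (w : 'I_N -> R).
Hypothesis sigma_gt0 : forall i, 0 < sigma i.
Hypothesis q_off : forall i j, i != j -> 0 <= q i j.
Hypothesis q_sum : forall i, \sum_j q i j <= 0.
Hypothesis h_ge0 : forall k, 0 <= complex.Re (h 0 k).
Hypothesis w_gt0 : forall k, 0 < w k.
Hypothesis qw_lt : forall k, \sum_j q k j * w j < complex.Re (h 0 k) * w k.

(** The off-diagonal terms in [qw_lt] are non-negative, so the diagonal term alone satisfies the
    strict inequality. *)
Lemma diag_gap k : 0 < complex.Re (h 0 k) - q k k.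
Proof.
rewrite subr_gt0 -(ltr_pM2r (w_gt0 k)); apply: le_lt_trans (qw_lt k).
rewrite (bigD1 k) //= lerDl sumr_ge0 // => j jk.
by rewrite mulr_ge0 ?q_off ?ltW // eq_sym.
Qed.

Lemma exists_plus : exists (W : 'M[C]_(N, np + n0)) G,
  [/\ rowsub selP W = 1%:M, wh_eq q srow (fun k => vvrow 0 k) h W G, Dmat G &
      (forall k, h 0 k = 'Re (h 0 k)) -> subgenerator G /\ subprob W].
Proof.
have [| |W [G [We WG DG rG]]] := @wh_exists R N _ selP q srow (fun k => vvrow 0 k) h
    selP_inj q_off q_sum h_ge0 diag_gap srow_ge0.
- move=> i; rewrite /selP; case: (split_ordP i) => {i} i ->.
    by rewrite vvrow_up.
  by have := srow_Z i sigma_gt0; rewrite /selZ => /lt0r_neq0/eqP.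
- move=> k; case: (split_ordP k) => {k} k ->; first by rewrite codom_f.
  by rewrite srow_down vvrow_down.
exists W, G; split=> //.
by apply/matrixP => i j; rewrite mxE We mxE.
Qed.

(** Negating [v] exchanges the roles of [E^+] and [E^-]: the rows of [E^-] now have [v = 1] and can
    be selected. *)
Lemma exists_minus : exists (W : 'M[C]_(N, n0 + nm)) G,
  [/\ rowsub selM W = 1%:M, wh_eq q srow (fun k => - vvrow 0 k) h W G, Dmat G &
      (forall k, h 0 k = 'Re (h 0 k)) -> subgenerator G /\ subprob W].
Proof.
have [| |W [G [We WG DG rG]]] := @wh_exists R N _ selM q srow (fun k => - vvrow 0 k) h
    selM_inj q_off q_sum h_ge0 diag_gap srow_ge0.
- move=> i; case: (split_ordP i) => {i} i ->.
    rewrite selM_lshift.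
    by have := srow_Z i sigma_gt0; rewrite /selZ => /lt0r_neq0/eqP.
  by rewrite selM_rshift vvrow_down opprK.
- move=> k; case: (split_ordP k) => {k} k ->; last by rewrite -selM_rshift codom_f.
  case: (split_ordP k) => {k} k ->; last by rewrite -/(selZ k) -selM_lshift codom_f.
  by rewrite srow_up vvrow_up.
exists W, G; split=> //.
by apply/matrixP => i j; rewrite mxE We mxE.
Qed.

Lemma nonZ_rows k : k \notin codom selZ -> srow k = 0 /\ vvrow 0 k * vvrow 0 k = 1.
Proof.
case: (split_ordP k) => {k} k -> kZ; last by rewrite srow_down vvrow_down mulrNN mulr1.
move: kZ; case: (split_ordP k) => {k} k ->; last by rewrite -/(selZ k) codom_f.
by rewrite srow_up vvrow_up mulr1.
Qed.

(** A common eigenvalue [a] of [G] and [- H] would satisfy [Re a <= 0] and [Re (- a) <= 0], hence be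
    imaginary, which is excluded. *)
Lemma disjoint_spectra m1 m2 (e : 'I_m1 -> 'I_N) W (G : 'M[C]_m1) (H : 'M[C]_m2) a :
  rowsub e W = 1%:M -> wh_eq q srow (fun k => vvrow 0 k) h W G ->
  Dmat G -> Dmat H -> eigenvalue G a -> ~~ eigenvalue (- H) a.
Proof.
move=> We WG DG DH Ga; apply/negP => /eigenvalueN Ha.
have := @wh_eigenvalue_neq0 R N q srow (fun k => vvrow 0 k) w h q_off srow_ge0 w_gt0
  qw_lt _ e W G We WG a Ga.
have := DG _ Ga; have := DH _ Ha; rewrite -!complexRe -[0](rmorph0 (real_complex R)) !lecRR.
rewrite raddfN /= oppr_le0 => a1 a2; case/negP; by rewrite eq_le a1 a2.
Qed.

(** [wh_unique] is used twice, each sign serving as the complementary solution for the other; the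
    sizes [np + n0] and [n0 + nm] add up to [N + n0]. *)
Lemma unique_pair Wp Gp Wm Gm Wp' Gp' Wm' Gm' :
  rowsub selP Wp = 1%:M -> wh_eq q srow (fun k => vvrow 0 k) h Wp Gp -> Dmat Gp ->
  rowsub selM Wm = 1%:M -> wh_eq q srow (fun k => - vvrow 0 k) h Wm Gm -> Dmat Gm ->
  rowsub selP Wp' = 1%:M -> wh_eq q srow (fun k => vvrow 0 k) h Wp' Gp' -> Dmat Gp' ->
  rowsub selM Wm' = 1%:M -> wh_eq q srow (fun k => - vvrow 0 k) h Wm' Gm' -> Dmat Gm' ->
  [/\ Wp' = Wp, Gp' = Gp, Wm' = Wm & Gm' = Gm].
Proof.
move=> Pe PG PD Me /wh_eqN MG MD Pe' PG' PD' Me' /wh_eqN MG' MD'.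
have sZ i : srow (selZ i) != 0 by apply/lt0r_neq0/srow_Z.
have uniq := @wh_unique R N n0 selZ q srow (fun k => vvrow 0 k) h selZ_inj sZ nonZ_rows.
have [||-> ->] := uniq _ _ selP selM Wp Gp Wp' Gp' Wm (- Gm) _ Pe PG Pe' PG' Me MG.
- by rewrite (addnC n0 nm) addnA.
- move=> a Ha; split; apply/negP => Ga; move: Ha; apply/negP.
    exact: disjoint_spectra Pe PG PD MD Ga.
  exact: disjoint_spectra Pe' PG' PD' MD Ga.
have [||-> /oppr_inj ->] := uniq _ _ selM selP Wm (- Gm) Wm' (- Gm') Wp Gp _ Me MG Me' MG' Pe PG.
- by rewrite addnC (addnC n0 nm) addnA.
- by move=> a Ha; split; apply: disjoint_spectra Pe PG PD _ Ha.
by [].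
Qed.

End Assembly.

(** * The diagonals of the model, and conclusion *)

Lemma SigmaM_diag (R : realType) n0 (mp mm : 'I_n0 -> nat) (sigma : 'I_n0 -> R) :
  SigmaM mp mm sigma = diag_mx (sgrow (Np mp) (Nm mm) sigma).
Proof.
by rewrite /sgrow !diag_mx_row /SigmaM /diagf !raddf0.
Qed.

Lemma VM_diag (R : realType) n0 (mp mm : 'I_n0 -> nat) (mu : 'I_n0 -> R) :
  VM mp mm mu = diag_mx (vvrow (Np mp) (Nm mm) mu).
Proof.
rewrite /vvrow !diag_mx_row /VM /diagf !diag_const_mx; congr block_mx.
by rewrite raddfN.
Qed.

Theorem theorem5p2 (R : realType) (n0 : nat) (mp mm : 'I_n0 -> nat)
  (Q : 'M[R]_n0) (mu sigma lam p : 'I_n0 -> R)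
  (betap : forall i, 'rV[R]_(mp i)) (Bp : forall i, 'M[R]_(mp i))
  (betam : forall i, 'rV[R]_(mm i)) (Bm : forall i, 'M[R]_(mm i)) :
  generator Q ->
  (forall i, 0 < sigma i) ->
  (forall i, 0 <= lam i) ->
  (forall i, 0 <= p i <= 1) ->
  (forall i, PHparams (betap i) (Bp i)) ->
  (forall i, PHparams (betam i) (Bm i)) ->
  let Np := Np mp in
  let Nm := Nm mm in
  let Sig := toC (SigmaM mp mm sigma) in
  let V := toC (VM mp mm mu) in
  let Q0m := Q0 Q lam p betap Bp betam Bm in
  forall h : 'rV[R[i]]_((Np + n0) + Nm),
  in_H h ->
  exists (etap : 'M[R[i]]_((Np + n0) + Nm, Np + n0)) (Qp : 'M[R[i]]_(Np + n0))
         (etam : 'M[R[i]]_((Np + n0) + Nm, n0 + Nm)) (Qm : 'M[R[i]]_(n0 + Nm)),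
    (* (i) existence and uniqueness *)
    is_mWHF Sig V (Qh Q0m h) etap Qp etam Qm /\
    (forall Wp Gp Wm Gm, is_mWHF Sig V (Qh Q0m h) Wp Gp Wm Gm ->
        [/\ Wp = etap, Gp = Qp, Wm = etam & Gm = Qm]) /\
    (* (ii) real-valued h *)
    ((forall k, h 0 k = 'Re (h 0 k)) ->
       [/\ subgenerator Qp, subgenerator Qm, subprob etap & subprob etam] /\
       [/\
           (exists U : 'M[R[i]]_(Nm, Np + n0), etap = col_mx 1%:M U /\ subprob U) &
           (exists U : 'M[R[i]]_(Np, n0 + Nm),
               etam = castmx (addnA Np n0 Nm, erefl (n0 + Nm)) (col_mx U 1%:M)
               /\ subprob U)]).
Proof.
move=> Qgen sigma_gt0 lam_ge0 p01 PHp PHm /= h [h0 hE].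
set q := Q0 _ _ _ _ _ _ _.
have Re_ge0 k : 0 <= complex.Re (h 0 k).
  by have := h0 k; rewrite -complexRe -[0](rmorph0 (real_complex R)) lecRR.
have ReE_gt0 i : 0 < complex.Re (h 0 (lshift (Nm mm) (rshift (Np mp) i))).
  by have := hE i; rewrite -complexRe -[0](rmorph0 (real_complex R)) ltcRR.
have q_off i j : i != j -> 0 <= q i j by apply: Q0_off.
have q_sum i : \sum_j q i j <= 0 by rewrite /q Q0_sum.
have [w [w0 qw]] := Q0_weight lam p Qgen PHp PHm Re_ge0 ReE_gt0.
have [Wp [Gp [Pe PG PD Pr]]] := exists_plus mu sigma_gt0 q_off q_sum Re_ge0 w0 qw.
have [Wm [Gm [Me MG MD Mr]]] := exists_minus mu sigma_gt0 q_off q_sum Re_ge0 w0 qw.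
(* The sign in front of [V] is absorbed by negating the diagonal [vvrow]. *)
have minus_eq (W : 'M[R[i]]_((Np mp) + n0 + (Nm mm), n0 + (Nm mm))) G :
    2%:R^-1 *: (toC (SigmaM mp mm sigma) *m toC (SigmaM mp mm sigma) *m W *m (G *m G))
      + toC (VM mp mm mu) *m W *m G + Qh q h *m W = 0
    <-> wh_eq q (srow sigma) (fun k => - vvrow (Np mp) (Nm mm) mu 0 k) h W G.
  have vE k : (- vvrow (Np mp) (Nm mm) mu) 0 k = - vvrow (Np mp) (Nm mm) mu 0 k.
    by rewrite mxE.
  have := wh_eqP q h (sgrow (Np mp) (Nm mm) sigma) W G vE.
  by rewrite -SigmaM_diag raddfN /= -VM_diag map_mxN !mulNmx opprK.
have plus_eq (W : 'M[R[i]]_((Np mp) + n0 + (Nm mm), (Np mp) + n0)) G :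
    2%:R^-1 *: (toC (SigmaM mp mm sigma) *m toC (SigmaM mp mm sigma) *m W *m (G *m G))
      - toC (VM mp mm mu) *m W *m G + Qh q h *m W = 0
    <-> wh_eq q (srow sigma) (fun k => vvrow (Np mp) (Nm mm) mu 0 k) h W G.
  have := wh_eqP q h (sgrow (Np mp) (Nm mm) sigma) W G
    (fun k => erefl (vvrow (Np mp) (Nm mm) mu 0 k)).
  by rewrite -SigmaM_diag -VM_diag.
have [Up WpU] := (rowsub_selP Wp).1 Pe; have [Um WmU] := (rowsub_selM Wm).1 Me.
exists Wp, Gp, Wm, Gm; split; [|split].
- split=> //; split=> //; split; first by exists Up.
  split; first by exists Um.
  by split; [apply/plus_eq | apply/minus_eq].
- move=> Wp' Gp' Wm' Gm' [PD' [MD' [/rowsub_selP Pe' [/rowsub_selM Me']]]].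
  move=> [/plus_eq PG' /minus_eq MG'].
  exact: (unique_pair sigma_gt0 q_off w0 qw Pe PG PD Me MG MD Pe' PG' PD' Me' MG' MD').
move=> hr; have [sGp sWp] := Pr hr; have [sGm sWm] := Mr hr.
split; split=> //.
  exists Up; split=> //; split.
    by move=> i j; have := sWp.1 (rshift _ i) j; rewrite WpU col_mxEd.
  move=> i; have := sWp.2 (rshift _ i); congr (_ <= 1).
  by apply: eq_bigr => j _; rewrite WpU col_mxEd.
(* Locates the rows of [Um] in [Wm] through the reassociation cast, so that the bounds on [Wm] pass
   to [Um]. *)
have WmE i j : Wm (cast_ord (addnA (Np mp) n0 (Nm mm)) (lshift (n0 + (Nm mm)) i)) j = Um i j.
  by rewrite WmU castmxE /= cast_ordK cast_ord_id col_mxEu.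
exists Um; split=> //; split.
  by move=> i j; rewrite -WmE; apply: sWm.1.
move=> i; have := sWm.2 (cast_ord (addnA (Np mp) n0 (Nm mm)) (lshift (n0 + (Nm mm)) i)).
by congr (_ <= 1); apply: eq_bigr => j _; rewrite WmE.
Qed.
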